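(* Let $(M,\omega)$ be a symplectic manifold and $\nabla$ a Fedosov connection on its Weyl bundle. Then the map $$\mathbb D\colon\mathcal G_\nabla(M)\longrightarrow Z^1(M)[[\hbar]],\qquad g\longmapsto g^{-1}\nabla g,$$ on global sections is surjective, where $Z^1(M)[[\hbar]]$ is the space of formal power series in $\hbar$ of closed complex-valued $1$-forms on $M$.
   Context: $\hbar$ is a formal variable. Weyl bundle: $\mathcal W\to M$ has fibre $\mathcal W_x$ the completed Weyl algebra generated over $\mathbb C[[\hbar]]$ by $T^*_xM\otimes\mathbb C$ with $vw-wv=i\hbar\,\bar\omega_x(v,w)$ ($\bar\omega$ the symplectic structure on $T^*M$ induced by $\omega$), graded by $|v|=1$, $|\hbar|=2$. A Fedosov connection is a flat, $\mathbb C[[\hbar]]$-linear graded-derivation connection on $\Omega^\bullet(M;\mathcal W)$, with $\nabla f=df$ for $f\in C^\infty(M)$, of the form $\nabla=[A_{-1},-]+\nabla_0+\sum_{i\ge0}[A_i,-]$ with $\nabla_0$ a symplectic connection, $A_{-1}(X)=\frac{\omega(X,-)}{i\hbar}$, $A_i\in\Omega^1(M;(\frac1{i\hbar}\mathcal W)_i)$. $\mathcal W^+$: the bundle whose fibres consist of formal series $\sum_{k\ge0}a_k$ with $a_k$ of degree $k$ in $\mathcal W_x[\hbar^{-1}]$ ($|\hbar^{-1}|=-2$); $\nabla$ extends to these. $\mathcal Z\cong C^\infty_M[[\hbar]]$ is the centre (sheaf) of $\mathcal W$ and $\mathcal W^+$. $\mathcal T_{\mathcal F}$ is the sheaf of groups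 $\mathcal T_{\mathcal F}(U)=\{z\exp(x): z\in\mathcal Z^\times(U),\ x\in(\frac1{i\hbar}\mathcal W(U))_{\ge1}\}\subset\mathcal W^+(U)$. $\mathcal G_\nabla$ is the sheaf of groups of those $E\in\mathcal T_{\mathcal F}$ with $\nabla(E^{-1})E$ a formal power series in $\hbar$ of (scalar, i.e. central) $1$-forms. *)

(* Defs.v *)
From HB Require Import structures.
From mathcomp Require Import all_boot all_order all_algebra.
From mathcomp Require Import complex.
From mathcomp Require Import all_classical all_reals all_analysis.
Set Implicit Arguments.
Unset Strict Implicit.
Unset Printing Implicit Defensive.
Import Order.TTheory GRing.Theory Num.Theory numFieldNormedType.Exports.
Local Open Scope classical_set_scope.
Local Open Scope ring_scope.
Local Open Scope complex_scope.
Local Open Scope quotient_scope.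

(** [weyl w] is the associative unital [R[i]]-algebra generated by
   [V (x)_R R[i]], a central symbol [hbar] and its inverse, subject to
   [v u - u v = i hbar w(v, u)].  It is literally presented by generators and
   relations: terms modulo the least congruence that contains the algebra
   axioms and the relations.  Only real vectors are generators: their complex
   multiples are obtained by multiplying with the constants [WC c]. *)

Section WeylAlgebra.
Variables (R : realType) (V : lmodType R) (w : V -> V -> R).

Inductive wterm : Type :=
  | WC of R[i]
  | WV of V
  | Wh
  | Whinv
  | WD of wterm & wterm
  | WM of wterm & wterm.

Inductive weq : wterm -> wterm -> Prop :=
  | weq_refl s : weq s s
  | weq_sym s t : weq s t -> weq t s
  | weq_trans s t u : weq s t -> weq t u -> weq s u
  | weq_WD s s' t t' : weq s s' -> weq t t' -> weq (WD s t) (WD s' t')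
  | weq_WM s s' t t' : weq s s' -> weq t t' -> weq (WM s t) (WM s' t')
  | weq_addA s t u : weq (WD s (WD t u)) (WD (WD s t) u)
  | weq_addC s t : weq (WD s t) (WD t s)
  | weq_add0 s : weq (WD (WC 0) s) s
  | weq_addN s : weq (WD (WM (WC (-1)) s) s) (WC 0)
  | weq_mulA s t u : weq (WM s (WM t u)) (WM (WM s t) u)
  | weq_mul1 s : weq (WM (WC 1) s) s
  | weq_mulDl s t u : weq (WM (WD s t) u) (WD (WM s u) (WM t u))
  | weq_mulDr s t u : weq (WM s (WD t u)) (WD (WM s t) (WM s u))
  | weq_WCD c d : weq (WC (c + d)) (WD (WC c) (WC d))
  | weq_WCM c d : weq (WC (c * d)) (WM (WC c) (WC d))
  | weq_WCC c s : weq (WM (WC c) s) (WM s (WC c))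
  | weq_WVD u v : weq (WV (u + v)) (WD (WV u) (WV v))
  | weq_WVZ (r : R) v : weq (WV (r *: v)) (WM (WC r%:C) (WV v))
  | weq_hC s : weq (WM Wh s) (WM s Wh)
  | weq_hinv : weq (WM Wh Whinv) (WC 1)
  | weq_comm u v :
      weq (WM (WV u) (WV v))
          (WD (WM (WV v) (WV u)) (WM (WC ('i * (w u v)%:C)) Wh)).

HB.instance Definition _ := gen_eqMixin wterm.
HB.instance Definition _ := gen_choiceMixin wterm.

Definition weqb : rel wterm := fun s t => `[< weq s t >].

Lemma weqb_equiv : equiv_class_of weqb.
Proof.
split.
- by move=> s; apply/asboolP; exact: weq_refl.
- by move=> s t; apply/asboolP/asboolP; exact: weq_sym.
- by move=> t s u /asboolP st /asboolP tu; apply/asboolP; exact: weq_trans tu.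
Qed.

Canonical weqb_equiv_rel := EquivRelPack weqb_equiv.

Definition weyl : Type := {eq_quot weqb}.
HB.instance Definition _ := Choice.on weyl.
HB.instance Definition _ := Quotient.on weyl.

Definition wpi (s : wterm) : weyl := \pi_weyl s.

Lemma wpiP s t : wpi s = wpi t <-> weq s t.
Proof.
have eP : reflect (s = t %[mod weyl]) (weqb s t).
  exact: (eqmodP weqb_equiv_rel s t).
by split=> [/eP/asboolP//|st]; apply/eP/asboolP.
Qed.

Lemma wpi_repr (a : weyl) : wpi (repr a) = a.
Proof. exact: reprK. Qed.

Lemma weq_repr s : weq (repr (wpi s)) s.
Proof. by apply/wpiP; rewrite wpi_repr. Qed.

Definition wadd (a b : weyl) : weyl := wpi (WD (repr a) (repr b)).
Definition wmul (a b : weyl) : weyl := wpi (WM (repr a) (repr b)).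

Lemma waddE s t : wadd (wpi s) (wpi t) = wpi (WD s t).
Proof. by apply/wpiP/weq_WD; exact: weq_repr. Qed.

Lemma wmulE s t : wmul (wpi s) (wpi t) = wpi (WM s t).
Proof. by apply/wpiP/weq_WM; exact: weq_repr. Qed.

Definition wconst (c : R[i]) : weyl := wpi (WC c).
Definition wopp (a : weyl) : weyl := wmul (wconst (-1)) a.

Lemma wE (P : weyl -> Prop) : (forall s, P (wpi s)) -> forall a, P a.
Proof. by move=> Ps a; rewrite -(wpi_repr a). Qed.

Lemma waddA : associative wadd.
Proof.
elim/wE=> s; elim/wE=> t; elim/wE=> u.
by rewrite !waddE; apply/wpiP; exact: weq_addA.
Qed.

Lemma waddC : commutative wadd.
Proof.
by elim/wE=> s; elim/wE=> t; rewrite !waddE; apply/wpiP; exact: weq_addC.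
Qed.

Lemma wadd0 : left_id (wconst 0) wadd.
Proof. by elim/wE=> s; rewrite waddE; apply/wpiP; exact: weq_add0. Qed.

Lemma waddN : left_inverse (wconst 0) wopp wadd.
Proof.
by elim/wE=> s; rewrite /wopp wmulE waddE; apply/wpiP; exact: weq_addN.
Qed.

HB.instance Definition _ :=
  GRing.isZmodule.Build weyl waddA waddC wadd0 waddN.

Lemma wmulA : associative wmul.
Proof.
elim/wE=> s; elim/wE=> t; elim/wE=> u.
by rewrite !wmulE; apply/wpiP; exact: weq_mulA.
Qed.

Lemma wmul1 : left_id (wconst 1) wmul.
Proof. by elim/wE=> s; rewrite wmulE; apply/wpiP; exact: weq_mul1. Qed.

Lemma wconstC c a : wmul (wconst c) a = wmul a (wconst c).
Proof.
by elim/wE: a => s; rewrite !wmulE; apply/wpiP; exact: weq_WCC.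
Qed.

Lemma wmul1r : right_id (wconst 1) wmul.
Proof. by move=> a; rewrite -wconstC wmul1. Qed.

Lemma wmulDl : left_distributive wmul wadd.
Proof.
elim/wE=> s; elim/wE=> t; elim/wE=> u.
by rewrite !(waddE, wmulE); apply/wpiP; exact: weq_mulDl.
Qed.

Lemma wmulDr : right_distributive wmul wadd.
Proof.
elim/wE=> s; elim/wE=> t; elim/wE=> u.
by rewrite !(waddE, wmulE); apply/wpiP; exact: weq_mulDr.
Qed.

HB.instance Definition _ :=
  GRing.Zmodule_isPzRing.Build weyl wmulA wmul1 wmul1r wmulDl wmulDr.

Definition wscale (c : R[i]) (a : weyl) : weyl := wconst c * a.

Lemma wscaleA c d a : wscale c (wscale d a) = wscale (c * d) a.
Proof.
rewrite /wscale mulrA; congr (_ * a).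
by rewrite /GRing.mul /= wmulE; apply/wpiP/weq_sym; exact: weq_WCM.
Qed.

Lemma wscale1 : left_id 1 wscale.
Proof. by move=> a; rewrite /wscale [wconst 1 * a]wmul1. Qed.

Lemma wscaleDr : right_distributive wscale +%R.
Proof. by move=> c a b; rewrite /wscale mulrDr. Qed.

Lemma wscaleDl a : {morph wscale^~ a : c d / c + d}.
Proof.
move=> c d; rewrite /wscale -mulrDl; congr (_ * a).
by rewrite [RHS]waddE; apply/wpiP; exact: weq_WCD.
Qed.

HB.instance Definition _ :=
  GRing.Zmodule_isLmodule.Build R[i] weyl wscaleA wscale1 wscaleDr wscaleDl.

Definition wgen (v : V) : weyl := wpi (WV v).
Definition hbar : weyl := wpi Wh.
Definition hbarV : weyl := wpi Whinv.

End WeylAlgebra.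

(** A series [a : nat -> A] stands for the formal sum of its components [a k],
   where [a k] is meant to be of degree [k]. *)

Section Series.
Variables (A : pzRingType).
Implicit Types a b : nat -> A.

Definition sone : nat -> A := fun k => (k == 0%N)%:R.

Definition smul a b : nat -> A := fun k => \sum_(i < k.+1) a i * b (k - i)%N.

Definition spow a (j : nat) : nat -> A := iter j (smul a) sone.

(** The two-sided inverse of [a], with value 0 if there is none. *)
Definition sinv a : nat -> A :=
  xget 0 [set b | smul b a = sone /\ smul a b = sone].

End Series.

(** For [a 0 = 0] the powers [a ^ j] with [j > k] have no component of degree
   [k], so that the sum below is the whole exponential series. *)
Definition sexp (R : realType) (V : lmodType R) (w : V -> V -> R)
    (a : nat -> weyl w) : nat -> weyl w :=
  fun k => \sum_(j < k.+1) ((j`!)%:R)^-1 *: spow a j k.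

Definition partial (R : realType) (n : nat) (i : 'I_n) (f : 'rV[R]_n -> R) :
    'rV[R]_n -> R :=
  fun x => 'D_(delta_mx 0 i) f x.

Definition smooth_on (R : realType) (n : nat) (U : set 'rV[R]_n)
    (f : 'rV[R]_n -> R) : Prop :=
  forall (s : seq 'I_n) (x : 'rV[R]_n), U x ->
    differentiable (foldr (@partial R n) f s) x.

Record chart (R : realType) (n : nat) (M : topologicalType) : Type := Chart {
  cdom : set M;
  coord : M -> 'rV[R]_n;
  param : 'rV[R]_n -> M
}.

Definition is_chart (R : realType) (n : nat) (M : topologicalType)
    (c : chart R n M) : Prop :=
  [/\ open (cdom c),
      open (coord c @` cdom c),
      (forall x, cdom c x -> param c (coord c x) = x),
      {within cdom c, continuous (coord c)} &
      {within coord c @` cdom c, continuous (param c)}].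

Record manifold (R : realType) (n : nat) : Type := Manifold {
  mpoint :> topologicalType;
  manifold_hausdorff : hausdorff_space mpoint;
  manifold_countable : @second_countable mpoint;
  atlas : set (chart R n mpoint);
  atlas_chart : forall c, atlas c -> is_chart c;
  atlas_cover : forall x, exists2 c, atlas c & cdom c x;
  atlas_smooth : forall c d, atlas c -> atlas d -> forall i : 'I_n,
    smooth_on (coord c @` (cdom c `&` cdom d))
              (fun z => coord d (param c z) 0 i)
}.

Section Manifold.
Variables (R : realType) (n : nat) (M : manifold R n).

(** The tangent space at [x] is the coordinate space of a fixed chart around
   [x]; [cfield c v] is the vector field, on the domain of a chart [c], with
   constant coordinates [v] in [c]. *)

Definition chart_at (x : M) : chart R n M := s2val (cid2 (atlas_cover x)).

Definition tangent (x : M) : lmodType R := 'rV[R]_n.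
Definition cotangent (x : M) : lmodType R := 'cV[R]_n.

Definition pairing (x : M) (xi : cotangent x) (v : tangent x) : R :=
  ((v : 'rV[R]_n) *m (xi : 'cV[R]_n)) 0 0.

Definition cfield (c : chart R n M) (v : 'rV[R]_n) (y : M) : tangent y :=
  'D_v (fun z : 'rV[R]_n => coord (chart_at y) (param c z)) (coord c y).

Definition smooth_fun (U : set M) (f : M -> R) : Prop :=
  forall c, atlas c ->
    smooth_on (coord c @` (cdom c `&` U)) (fun z => f (param c z)).

Definition smooth_cfun (U : set M) (f : M -> R[i]) : Prop :=
  smooth_fun U (fun x => complex.Re (f x)) /\
  smooth_fun U (fun x => complex.Im (f x)).

Definition tdiff (f : M -> R) (x : M) (v : tangent x) : R :=
  'D_(v : 'rV[R]_n) (fun z => f (param (chart_at x) z))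
    (coord (chart_at x) x).

Definition tcdiff (f : M -> R[i]) (x : M) (v : tangent x) : R[i] :=
  tdiff (fun y => complex.Re (f y)) v +i* tdiff (fun y => complex.Im (f y)) v.

Definition smooth_cov (U : set M) (xi : forall x, cotangent x) : Prop :=
  forall c, atlas c -> forall i : 'I_n,
    smooth_fun (U `&` cdom c)
      (fun y => pairing (xi y) (cfield c (delta_mx 0 i) y)).

Definition dform (B : M -> Type) (p : nat) : Type :=
  forall x, ('I_p -> tangent x) -> B x.

(** [smB U] are the smooth sections over [U] of the bundle of coefficients. *)
Definition is_form (B : M -> lmodType R[i])
    (smB : set M -> (forall x, B x) -> Prop) (p : nat) (th : dform B p) : Prop :=
  [/\ (forall x (v : 'I_p -> tangent x) i (r : R) (u u' : tangent x),
         th x [eta v with i |-> r *: u + u'] =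
         r%:C *: th x [eta v with i |-> u] + th x [eta v with i |-> u']),
      (forall x (v : 'I_p -> tangent x) i j,
         i != j -> v i = v j -> th x v = 0) &
      (forall c, atlas c -> forall e : 'I_p -> 'I_n,
         smB (cdom c) (fun y => th y (fun i => cfield c (delta_mx 0 (e i)) y)))].

(** The extension to forms of a covariant derivative [D] on sections of [B]
   (the exterior derivative if [D] is the differential of functions):
     (d_D th)(v_0, .., v_p) =
        sum_j (-1)^j D_(v_j) (th(v_0, .., v_(j-1), v_(j+1), .., v_p)),
   where the [v_i] are extended around [x] to fields with constant coordinates
   in a chart.  These commute, so that no bracket terms appear. *)
Definition ext_deriv (B : M -> zmodType)
    (D : (forall x, B x) -> forall x, tangent x -> B x)
    (p : nat) (th : dform B p) : dform B p.+1 :=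
  fun x v => \sum_(j < p.+1)
    let a := D (fun y => th y (fun i : 'I_p =>
                   cfield (chart_at x) (v (lift j i)) y)) x (v j) in
    if odd j then - a else a.
Arguments ext_deriv {B} D {p} th x v.

Definition scalar_form (p : nat) (th : dform (fun=> R[i]^o) p) : Prop :=
  is_form (B := fun=> R[i]^o) smooth_cfun th.

Definition ext_d (p : nat) (th : dform (fun=> R[i]^o) p) :
    dform (fun=> R[i]^o) p.+1 :=
  ext_deriv (B := fun=> R[i]^o) tcdiff th.
Arguments ext_d {p} th x v.

(** [W x] is the Gram matrix of the form on [tangent x]. *)
Definition gram_form (W : forall x : M, 'M[R]_n) (x : M) (u v : tangent x) : R :=
  ((u : 'rV[R]_n) *m W x *m (v : 'rV[R]_n)^T) 0 0.

Record symplectic_form : Type := SymplecticForm {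
  sgram : forall x : M, 'M[R]_n;
  symplectic_alt : forall (x : M) (v : tangent x), gram_form sgram v v = 0;
  symplectic_nondeg : forall x : M, sgram x \in unitmx;
  symplectic_smooth : forall c, atlas c -> forall i j : 'I_n,
    smooth_fun (cdom c) (fun y =>
      gram_form sgram (cfield c (delta_mx 0 i) y) (cfield c (delta_mx 0 j) y));
  symplectic_closed : forall (x : M) (v : 'I_3 -> tangent x),
    ext_deriv (B := fun=> R : zmodType) tdiff
      (fun y (u : 'I_2 -> tangent y) => gram_form sgram (u 0) (u 1)) x v = 0
}.

Section Symplectic.
Variable om : symplectic_form.

Definition omega (x : M) (u v : tangent x) : R := gram_form (sgram om) u v.

(** [omega(v, -)], and the inverse isomorphism. *)
Definition flat (x : M) (v : tangent x) : cotangent x :=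
  ((v : 'rV[R]_n) *m sgram om x)^T.

Definition sharp (x : M) (xi : cotangent x) : tangent x :=
  (xi : 'cV[R]_n)^T *m invmx (sgram om x).

Definition omega_bar (x : M) (xi eta : cotangent x) : R :=
  omega (sharp xi) (sharp eta).

Definition wfib (x : M) : Type := weyl (@omega_bar x).
HB.instance Definition _ x := GRing.PzRing.on (wfib x).
HB.instance Definition _ x := GRing.Lmodule.on (wfib x).

Definition wsec : Type := forall x, wfib x.

(** Homogeneous sections of degree [k] over [U] generated by smooth functions,
   smooth 1-forms and [hbar], as well as its inverse if [hinv] is true. *)
Inductive wgenerated (hinv : bool) (U : set M) : int -> wsec -> Prop :=
  | wgenerated_fun f : smooth_cfun U f ->
      wgenerated hinv U 0 (fun x => wconst (@omega_bar x) (f x))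
  | wgenerated_cov xi : smooth_cov U xi ->
      wgenerated hinv U 1 (fun x => wgen (@omega_bar x) (xi x))
  | wgenerated_hbar : wgenerated hinv U 2 (fun x => hbar (@omega_bar x))
  | wgenerated_hbarV : hinv ->
      wgenerated hinv U (-2) (fun x => hbarV (@omega_bar x))
  | wgenerated_add k a b : wgenerated hinv U k a -> wgenerated hinv U k b ->
      wgenerated hinv U k (fun x => a x + b x)
  | wgenerated_mul k l a b : wgenerated hinv U k a -> wgenerated hinv U l b ->
      wgenerated hinv U (k + l) (fun x => a x * b x).

(** Smooth sections over [U] of the degree [k] part of the Weyl bundle
   ([hinv = false]), resp. of the Weyl bundle with [hbar] inverted
   ([hinv = true]). *)
Definition wsmooth (hinv : bool) (k : int) (U : set M) (a : wsec) : Prop :=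
  forall x, U x -> exists V, [/\ open V, V x &
    exists2 b, wgenerated hinv V k b & forall y, V y -> a y = b y].

Definition wform (hinv : bool) (k : int) (p : nat) (th : dform wfib p) : Prop :=
  is_form (B := fun x => wfib x : lmodType R[i]) (wsmooth hinv k) th.

(** Fibre of the bundle W^+; its elements are sequences [a] with [a k] of
   degree [k].  A section of W is a sequence of [wsmooth false k] sections. *)
Definition wplus (x : M) : Type := nat -> wfib x.
HB.instance Definition _ x := GRing.Zmodule.on (wplus x).

Definition Wform (p : nat) (th : dform wplus p) : Prop :=
  forall k : nat, wform false k%:Z (fun x v => th x v k).

(** [\sum_m hbar ^ m f_m]; [hbar ^ m] has degree [2 m]. *)
Definition central (x : M) (f : nat -> R[i]) : wplus x :=
  fun k => if odd k then 0 else f k./2 *: hbar (@omega_bar x) ^+ k./2.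

(** A connection is a morphism of sheaves.  It is encoded as an operator on all
   set-theoretic sections that only depends on germs; its values on sections
   that are not smooth are irrelevant. *)
Record symplectic_connection
    (D : (forall x, cotangent x) -> forall x, tangent x -> cotangent x) :
    Prop := SymplecticConnection {
  sconn_local : forall (U : set M) xi eta, open U ->
    (forall x, U x -> xi x = eta x) ->
    forall x v, U x -> D xi x v = D eta x v;
  sconn_linear : forall (U : set M) xi, open U -> smooth_cov U xi ->
    forall x (r : R) (u v : tangent x), U x ->
    D xi x (r *: u + v) = r *: D xi x u + D xi x v;
  sconn_add : forall (U : set M) xi eta, open U ->
    smooth_cov U xi -> smooth_cov U eta ->
    forall x v, U x -> D (fun y => xi y + eta y) x v = D xi x v + D eta x v;
  sconn_leibniz : forall (U : set M) (f : M -> R) xi, open U ->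
    smooth_fun U f -> smooth_cov U xi ->
    forall x v, U x ->
    D (fun y => f y *: xi y) x v = tdiff f v *: xi x + f x *: D xi x v;
  sconn_smooth : forall (U : set M) xi, open U -> smooth_cov U xi ->
    forall c, atlas c -> forall i : 'I_n,
    smooth_cov (U `&` cdom c) (fun y => D xi y (cfield c (delta_mx 0 i) y));
  sconn_torsion_free : forall (U : set M) xi, open U -> smooth_cov U xi ->
    forall x (u v : tangent x), U x ->
    pairing (D xi x u) v - pairing (D xi x v) u =
    ext_deriv (B := fun=> R : zmodType) tdiff
      (fun y (t : 'I_1 -> tangent y) => pairing (xi y) (t 0))
      x (fun i => if i == 0 then u else v);
  sconn_symplectic : forall (U : set M) xi eta, open U ->
    smooth_cov U xi -> smooth_cov U eta ->
    forall x v, U x ->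
    tdiff (fun y => omega_bar (xi y) (eta y)) v =
    omega_bar (D xi x v) (eta x) + omega_bar (xi x) (D eta x v)
}.

(** [D0] is the derivation induced by [D] on sections of the Weyl bundle (with
   [hbar] inverted); the conditions determine it. *)
Record induced_connection
    (D : (forall x, cotangent x) -> forall x, tangent x -> cotangent x)
    (D0 : wsec -> forall x, tangent x -> wfib x) : Prop := InducedConnection {
  iconn_local : forall (U : set M) (a b : wsec), open U ->
    (forall x, U x -> a x = b x) ->
    forall x (v : tangent x), U x -> D0 a x v = D0 b x v;
  iconn_linear : forall (U : set M) k a, open U -> wsmooth true k U a ->
    forall x (r : R) (u v : tangent x), U x ->
    D0 a x (r *: u + v) = r%:C *: D0 a x u + D0 a x v;
  iconn_add : forall (U : set M) k a b, open U ->
    wsmooth true k U a -> wsmooth true k U b ->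
    forall x (v : tangent x), U x ->
    D0 (fun y => a y + b y) x v = D0 a x v + D0 b x v;
  iconn_mul : forall (U : set M) k l a b, open U ->
    wsmooth true k U a -> wsmooth true l U b ->
    forall x (v : tangent x), U x ->
    D0 (fun y => a y * b y) x v = D0 a x v * b x + a x * D0 b x v;
  iconn_fun : forall (U : set M) f, open U -> smooth_cfun U f ->
    forall x (v : tangent x), U x ->
    D0 (fun y => wconst (@omega_bar y) (f y)) x v =
    wconst (@omega_bar x) (tcdiff f v);
  iconn_cov : forall (U : set M) xi, open U -> smooth_cov U xi ->
    forall x (v : tangent x), U x ->
    D0 (fun y => wgen (@omega_bar y) (xi y)) x v =
    wgen (@omega_bar x) (D xi x v);
  iconn_hbar : forall x (v : tangent x),
    D0 (fun y => hbar (@omega_bar y)) x v = 0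
}.

Definition wcomm (x : M) (a b : wfib x) : wfib x := a * b - b * a.

(** [A_{-1}(v) = omega(v, -) / (i hbar)] *)
Definition Aminus1 (x : M) (v : tangent x) : wfib x :=
  ('i : R[i])^-1 *: (hbarV (@omega_bar x) * wgen (@omega_bar x) (flat v)).

(** [[A_{-1}, -] + D0 + \sum_i [A_i, -]] on sections.  The omitted component
   [[A_{-1}, a_0]] of degree -1 vanishes if [a_0] is a scalar, as is the case
   for the sections of W and of the group sheaf [TF]. *)
Definition covariant (D0 : wsec -> forall x, tangent x -> wfib x)
    (A : nat -> dform wfib 1) (a : forall x, wplus x) (x : M) (v : tangent x) :
    wplus x :=
  fun k => wcomm (Aminus1 v) (a x k.+1) + D0 (fun y => a y k) x v
           + \sum_(i < k.+1) wcomm (A i x (fun=> v)) (a x (k - i)%N).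

(** [C[[hbar]]]-linearity, the graded derivation property of the extension to
   forms and [nabla f = df] follow from the form of [covariant]. *)
Record fedosov_connection : Type := FedosovConnection {
  fconn : (forall x, cotangent x) -> forall x, tangent x -> cotangent x;
  fconn_symplectic : symplectic_connection fconn;
  fconn0 : wsec -> forall x, tangent x -> wfib x;
  fconn0_induced : induced_connection fconn fconn0;
  fconnA : nat -> dform wfib 1;
  fconnA_form : forall i : nat, wform false (i.+2)%:Z
    (fun x v => ('i *: hbar (@omega_bar x)) * @fconnA i x v);
  fconn_flat : forall (p : nat) (th : dform wplus p), Wform th ->
    forall x v,
    ext_deriv (B := fun x => wplus x : zmodType) (covariant fconn0 fconnA)
      (ext_deriv (B := fun x => wplus x : zmodType)
         (covariant fconn0 fconnA) th) x v = 0
}.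

Definition nabla (F : fedosov_connection) (p : nat) (th : dform wplus p) :
    dform wplus p.+1 :=
  ext_deriv (B := fun x => wplus x : zmodType)
    (covariant (fconn0 F) (fconnA F)) th.
Arguments nabla F {p} th x v.

Definition nabla0 (F : fedosov_connection) (g : forall x, wplus x) :
    dform wplus 1 :=
  nabla F (fun x (_ : 'I_0 -> tangent x) => g x).
Arguments nabla0 F g x v : clear implicits.

Definition Zsec : set (forall x, wplus x) :=
  [set z | exists2 f : nat -> M -> R[i],
     (forall m, smooth_cfun setT (f m)) &
     forall x, z x = central x (fun m => f m x)].

Definition Zunit : set (forall x, wplus x) :=
  [set z | Zsec z /\
     exists2 z', Zsec z' & forall x, smul (z x) (z' x) = sone (wfib x)].

(** Sections of degree at least 1 of W / (i hbar). *)
Definition Wge1 : set (forall x, wplus x) :=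
  [set a | (forall x, a x 0%N = 0) /\
     forall k : nat, wsmooth false (k.+2)%:Z setT
       (fun x => ('i *: hbar (@omega_bar x)) * a x k)].

Definition TF : set (forall x, wplus x) :=
  [set g | exists z a, [/\ Zunit z, Wge1 a &
     forall x, g x = smul (z x) (sexp (a x))]].

Definition central_form (alpha : nat -> dform (fun=> R[i]^o) 1) : dform wplus 1 :=
  fun x v => central x (fun m => alpha m x v).
Arguments central_form alpha x v : clear implicits.

Definition Gnabla (F : fedosov_connection) : set (forall x, wplus x) :=
  [set g | TF g /\
     exists2 beta : nat -> dform (fun=> R[i]^o) 1,
       (forall m, scalar_form (beta m)) &
       forall x v, smul (nabla0 F (fun y => sinv (g y)) x v) (g x) =
                   central_form beta x v].

Definition Z1hbar : set (dform wplus 1) :=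
  [set th | exists2 alpha : nat -> dform (fun=> R[i]^o) 1,
     (forall m, scalar_form (alpha m) /\
                forall x v, ext_d (alpha m) x v = 0) &
     forall x v, th x v = central_form alpha x v].

Definition log_deriv (F : fedosov_connection) (g : forall x, wplus x) :
    dform wplus 1 :=
  fun x v => smul (sinv (g x)) (nabla0 F g x v).
Arguments log_deriv F g x v : clear implicits.

End Symplectic.
End Manifold.

Arguments ext_deriv {R n M B} D {p} th x v.
Arguments ext_d {R n M p} th x v.
Arguments central {R n M} om x f k.
Arguments central_form {R n M} om alpha x v.
Arguments covariant {R n M om} D0 A a x v k.
Arguments nabla {R n M om} F {p} th x v.
Arguments nabla0 {R n M om} F g x v.
Arguments log_deriv {R n M om} F g x v.
Arguments Zsec {R n M} om z.
Arguments Zunit {R n M} om z.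
Arguments Wge1 {R n M} om a.
Arguments TF {R n M} om g.
Arguments Gnabla {R n M om} F g.
Arguments Z1hbar {R n M} om th.

(* Main.v *)
(** If [a] is a section of W of degree at least 1 with [nabla a = alpha], then,
   [alpha] being central, [nabla (exp a) = exp a * alpha], so that [z = 1] and
   [exp a] are as required.  Such an [a] is built degree by degree.  The lowest
   term of [nabla] is, up to sign, the Koszul differential [delta] of the
   symmetric algebra; flatness of [nabla] and closedness of [alpha] make the
   obstruction in each degree [delta]-closed, hence [delta]-exact.

   The Poincare lemma for [delta] is proved without a PBW basis.  With
   [d_i = [A_{-1}(e_i), -]] and generators [y_i] dual to the [e_i], the operator
   [N = - \sum_i y_i d_i] satisfies [d_i N = (N + 1) d_i]; by induction on the
   degree, [N (N - 1) .. (N - k) = 0] on elements of degree [k].  As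
   [d_j (- \sum_i y_i th_i) = (1 + N) th_j] for a closed [th], subtracting
   multiples of the coboundaries of [- \sum_i y_i th_i] removes the factors
   [N - m] one after the other. *)

Require Import Defs.
From HB Require Import structures.
From mathcomp Require Import all_boot all_order all_algebra.
From mathcomp Require Import complex ring.
From mathcomp Require Import all_classical all_reals all_analysis.
(* Again, because [coord] is shadowed by the one of [vector]. *)
Require Import Defs.
Set Implicit Arguments.
Unset Strict Implicit.
Unset Printing Implicit Defensive.
Import Order.TTheory GRing.Theory Num.Theory numFieldNormedType.Exports.
Local Open Scope classical_set_scope.
Local Open Scope ring_scope.
Local Open Scope complex_scope.

(** * Functions of class C^k *)

(** In the absence of a normal form, smoothness of a section of the Weyl bundle cannot be read off
    from coefficients: it means being locally a finite expression in smooth functions, smooth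
    covector fields and [hbar]. The operators [[A_{-1}, -]], the induced connection and [[A_i, -]]
    are therefore shown to preserve smooth sections by induction on such expressions. A second
    obstacle is that the tangent space at [x] is a coordinate space through [chart_at x], which may
    change abruptly with [x]; formulas are moved to the frame of a fixed chart before their
    smoothness is checked. The contraction [- \sum_i y_i th_i] is a sum over dual bases, hence
    canonical, so that primitives for [delta] are global at once, whatever the topology of [M]. *)

Section Calculus.
Variable R : realType.

Lemma differentiable_near_eq (V W : normedModType R) (f g : V -> W) (x : V) :
  (\forall y \near x, f y = g y) -> differentiable f x -> differentiable g x.
Proof.
move=> fg df.
have gx : g x = f x by rewrite (nbhs_singleton fg).
have dfc : continuous ('d f x) by exact: diff_continuous.
have eqo : g \o shift x = cst (g x) + 'd f x +o_ 0 id.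
  apply/eqaddoP => e e0; rewrite gx.
  have /eqaddoP /(_ _ e0) H := diff_locally df.
  have fg0 : \forall h \near (0 : V), f (h + x) = g (h + x).
    by move: fg; rewrite (near_shift 0 x) subr0.
  near=> h.
  rewrite /= !fctE /= -(near fg0 h) //.
  exact: (near H h).
apply/diff_locallyP; have -> : 'd g x = 'd f x :> (V -> W).
  exact: diff_unique.
by [].
Unshelve. all: by end_near. Qed.

Lemma differentiable_rV (V : normedModType R) n (f : V -> 'rV[R]_n) (x : V) :
  (forall j, differentiable (fun y => f y 0 j) x) -> differentiable f x.
Proof.
move=> df.
have -> : f = \sum_(j < n) (fun y => f y 0 j *: delta_mx 0 j).
  apply/funext => y; rewrite fct_sumE.
  exact: row_sum_delta.
by apply: differentiable_sum => j; exact: differentiableZl.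
Qed.

Variable n : nat.
Implicit Types (U : set 'rV[R]_n) (f g : 'rV[R]_n -> R).

Lemma derive_partial f x v : differentiable f x ->
  'D_v f x = \sum_(j < n) v 0 j * partial j f x.
Proof.
move=> df; rewrite deriveE // [in LHS](row_sum_delta v) linear_sum /=.
by apply: eq_bigr => j _; rewrite linearZ /= /partial deriveE.
Qed.

Lemma derive_coord (V : normedModType R) (f : V -> 'rV[R]_n) x v j :
  differentiable f x -> ('D_v f x) 0 j = 'D_v (fun y => f y 0 j) x.
Proof. by move=> df; rewrite derive_mx ?mxE //; exact: diff_derivable. Qed.

Lemma derive_comp (V : normedModType R) (W : normedModType R)
    (f : V -> 'rV[R]_n) (g : 'rV[R]_n -> W) x v :
  differentiable f x -> differentiable g (f x) ->
  'D_v (g \o f) x = 'D_('D_v f x) g (f x).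
Proof.
move=> df dg; rewrite !deriveE //; last exact: differentiable_comp.
by rewrite diff_comp.
Qed.

(** Closure properties go by induction on the order of differentiation, so smoothness is cut into
    finite orders; [CkS] provides the induction step. *)
Definition Ck (k : nat) U f := forall s : seq 'I_n, (size s <= k)%N ->
  forall x, U x -> differentiable (foldr (@partial R n) f s) x.

Lemma smooth_onE U f : smooth_on U f <-> forall k, Ck k U f.
Proof.
split=> [fs k s _ x Ux|fs s x Ux]; first exact: fs.
exact: (fs (size s)).
Qed.

Lemma Ck_differentiable k U f x : Ck k U f -> U x -> differentiable f x.
Proof. by move=> /(_ [::]); apply. Qed.

Lemma CkW k U f : Ck k.+1 U f -> Ck k U f.
Proof. by move=> fk s sk; apply: fk; exact: leqW. Qed.

Lemma Ck0 U f : (forall x, U x -> differentiable f x) -> Ck 0 U f.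
Proof. by move=> df [|//] _; exact: df. Qed.

(** [foldr] applies the last index of the list first, hence the splitting of lists at their right
    end. *)
Lemma CkS k U f : Ck k.+1 U f <->
  (forall x, U x -> differentiable f x) /\ forall i, Ck k U (partial i f).
Proof.
split=> [fk|[df fk]].
  split=> [x Ux|i s sk x Ux]; first exact: (fk [::]).
  by have := fk (rcons s i); rewrite size_rcons foldr_rcons; apply.
elim/last_ind => [|s i _]; first by move=> _; exact: df.
by rewrite size_rcons foldr_rcons => sk x Ux; exact: fk.
Qed.

Lemma open_near U (P : 'rV[R]_n -> Prop) x : open U -> U x ->
  (forall y, U y -> P y) -> \forall y \near x, P y.
Proof. by move=> oU Ux UP; apply: filterS UP _; exact: open_nbhs_nbhs. Qed.

Lemma Ck_ext k U f g : open U -> (forall x, U x -> f x = g x) ->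
  Ck k U f -> Ck k U g.
Proof.
move=> oU; elim: k f g => [|k IH] f g fg.
  move=> fk; apply: Ck0 => x Ux; apply: differentiable_near_eq (fk [::] _ _ Ux) => //.
  exact: open_near fg.
move=> /CkS [df fk]; apply/CkS; split=> [x Ux|i].
  by apply: differentiable_near_eq (df _ Ux); exact: open_near fg.
apply: IH (fk i) => x Ux; rewrite /partial; apply: near_eq_derive.
exact: open_near fg.
Qed.

Lemma Ck_subset k U U' f : U' `<=` U -> Ck k U f -> Ck k U' f.
Proof. by move=> U'U fk s sk x /U'U; exact: fk. Qed.

Lemma Ck_cst k U (a : R) : open U -> Ck k U (fun=> a).
Proof.
move=> oU; elim: k a => [|k IH] a.
  by apply: Ck0 => x _; exact: differentiable_cst.
apply/CkS; split=> [x _|i]; first exact: differentiable_cst.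
apply: (Ck_ext oU) (IH 0) => x Ux; rewrite /partial; exact/esym/derive_cst.
Qed.

Lemma Ck_add k U f g : open U -> Ck k U f -> Ck k U g ->
  Ck k U (fun x => f x + g x).
Proof.
move=> oU; elim: k f g => [|k IH] f g fk gk.
  by apply: Ck0 => x Ux; apply: differentiableD; [exact: (fk [::])|exact: (gk [::])].
move: fk gk => /CkS [df fk] /CkS [dg gk].
apply/CkS; split=> [x Ux|i]; first by apply: differentiableD; [exact: df|exact: dg].
apply: (Ck_ext oU) (IH _ _ (fk i) (gk i)) => x Ux.
by rewrite /partial -deriveD //; apply: diff_derivable; [exact: df|exact: dg].
Qed.

Lemma Ck_mul k U f g : open U -> Ck k U f -> Ck k U g ->
  Ck k U (fun x => f x * g x).
Proof.
move=> oU; elim: k f g => [|k IH] f g fk gk.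
  by apply: Ck0 => x Ux; apply: differentiableM; [exact: (fk [::])|exact: (gk [::])].
move: (fk) (gk) => /CkS [df fk'] /CkS [dg gk'].
apply/CkS; split=> [x Ux|i]; first by apply: differentiableM; [exact: df|exact: dg].
apply: (Ck_ext oU) (Ck_add oU (IH _ _ (CkW fk) (gk' i)) (IH _ _ (CkW gk) (fk' i))).
move=> x Ux.
have H : 'D_(delta_mx 0 i) (f * g) x =
    f x *: 'D_(delta_mx 0 i) g x + g x *: 'D_(delta_mx 0 i) f x.
  by rewrite -deriveM //; apply: diff_derivable; [exact: df|exact: dg].
by rewrite /partial H.
Qed.

Lemma Ck_sum k U (I : Type) (r : seq I) (h : I -> 'rV[R]_n -> R) : open U ->
  (forall j, Ck k U (h j)) -> Ck k U (fun x => \sum_(j <- r) h j x).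
Proof.
move=> oU hk; elim: r => [|j r IH].
  by apply: (Ck_ext oU _ (Ck_cst 0 oU)) => x _; rewrite big_nil.
by apply: (Ck_ext oU) (Ck_add oU (hk j) IH) => x _; rewrite big_cons.
Qed.

Lemma Ck_prod k U (I : Type) (r : seq I) (h : I -> 'rV[R]_n -> R) : open U ->
  (forall j, Ck k U (h j)) -> Ck k U (fun x => \prod_(j <- r) h j x).
Proof.
move=> oU hk; elim: r => [|j r IH].
  by apply: (Ck_ext oU _ (Ck_cst 1 oU)) => x _; rewrite big_nil.
by apply: (Ck_ext oU) (Ck_mul oU (hk j) IH) => x _; rewrite big_cons.
Qed.

Lemma Ck_inv k U f : open U -> (forall x, U x -> f x != 0) -> Ck k U f ->
  Ck k U (fun x => (f x)^-1).
Proof.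
move=> oU f0; elim: k => [|k IH] fk.
  by apply: Ck0 => x Ux; apply: differentiableV; [exact: (fk [::])|exact: f0].
move: (fk) => /CkS [df fk'].
apply/CkS; split=> [x Ux|i]; first by apply: differentiableV; [exact: df|exact: f0].
have Ik := IH (CkW fk).
apply: (Ck_ext oU) (Ck_mul oU (Ck_mul oU (Ck_cst (-1) oU) (fk' i)) (Ck_mul oU Ik Ik)).
move=> x Ux; rewrite /partial.
have -> : (fun x0 => (f x0)^-1) = GRing.inv \o f by [].
have H := @deriveV R _ f x (delta_mx 0 i) (f0 _ Ux) (diff_derivable (df _ Ux)).
rewrite [RHS]H -exprVn expr2 /GRing.scale /=; ring.
Qed.

End Calculus.

(** By the chain rule the partial derivatives of the composite involve those of [g] at the same
    inner map, so the induction varies [g] and keeps [f]. *)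
Lemma Ck_comp (R : realType) n k (U V : set 'rV[R]_n) (f : 'rV[R]_n -> 'rV[R]_n) g :
  open U -> open V -> (forall x, U x -> V (f x)) ->
  (forall j, Ck k U (fun x => f x 0 j)) -> Ck k V g -> Ck k U (fun x => g (f x)).
Proof.
move=> oU oV UV; elim: k g => [|k IH] g fk gk.
  apply: Ck0 => x Ux; apply: differentiable_comp.
    by apply: differentiable_rV => j; exact: (fk j [::]).
  exact: (gk [::] _ _ (UV _ Ux)).
have df x : U x -> differentiable f x.
  by move=> Ux; apply: differentiable_rV => j; exact: (fk j [::]).
move: (gk) => /CkS [dg gk'].
apply/CkS; split=> [x Ux|i].
  by apply: differentiable_comp; [exact: df|exact: dg (UV _ Ux)].
apply: (Ck_ext oU (f := fun x =>
  \sum_(j < n) partial i (fun y => f y 0 j) x * partial j g (f x))).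
  move=> x Ux; rewrite /partial [RHS](derive_comp _ (df _ Ux) (dg _ (UV _ Ux))).
  rewrite derive_partial; last exact: dg (UV _ Ux).
  by apply: eq_bigr => j _; rewrite derive_coord //; exact: df.
apply: Ck_sum => // j; apply: Ck_mul => //.
  by have /CkS[_] := fk j; apply.
apply: IH => // j'; exact: CkW.
Qed.

Lemma Ck_det (R : realType) n k (U : set 'rV[R]_n) m (A : 'rV[R]_n -> 'M[R]_m) :
  open U ->
  (forall i j, Ck k U (fun x => A x i j)) -> Ck k U (fun x => \det (A x)).
Proof.
move=> oU Ak; rewrite /determinant; apply: Ck_sum => // t.
by apply: Ck_mul => //; [exact: Ck_cst|exact: Ck_prod].
Qed.

(** Cramer's rule. It yields the smoothness of the Poisson tensor from that of the symplectic
    form. *)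
Lemma Ck_invmx (R : realType) n k (U : set 'rV[R]_n) m
    (A : 'rV[R]_n -> 'M[R]_m) : open U ->
  (forall x, U x -> A x \in unitmx) ->
  (forall i j, Ck k U (fun x => A x i j)) ->
  forall i j, Ck k U (fun x => invmx (A x) i j).
Proof.
move=> oU uA Ak i j.
have dk : Ck k U (fun x => (\det (A x))^-1).
  apply: Ck_inv => //; last exact: Ck_det.
  by move=> x Ux; rewrite -unitfE; exact: uA.
have ck : Ck k U (fun x => (-1) ^+ (j + i) * \det (row' j (col' i (A x)))).
  apply: Ck_mul => //; first exact: Ck_cst.
  apply: Ck_det => // a b.
  by apply: Ck_ext (Ak (lift j a) (lift i b)) => // x _; rewrite !mxE.
apply: (Ck_ext oU) (Ck_mul oU dk ck) => x Ux.
by rewrite /invmx uA // !mxE.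
Qed.

(** * The Weyl algebra *)

Section WeylAlgebraTheory.
Variables (R : realType) (V : lmodType R) (w : V -> V -> R).
Implicit Types a b : weyl w.
Local Notation wconst := (wconst w).
Local Notation wgen := (wgen w).
Local Notation hbar := (hbar w).
Local Notation hbarV := (hbarV w).

Lemma wscaleE (c : R[i]) a : c *: a = wconst c * a. Proof. by []. Qed.

Lemma wconst_scale (c : R[i]) : wconst c = c *: (1 : weyl w).
Proof. by rewrite wscaleE mulr1. Qed.

Lemma wscaleAl (c : R[i]) a b : c *: a * b = c *: (a * b).
Proof. by rewrite !wscaleE mulrA. Qed.

Lemma wscaleAr (c : R[i]) a b : a * (c *: b) = c *: (a * b).
Proof. by rewrite !wscaleE !mulrA; congr (_ * _); exact/esym/wconstC. Qed.

Lemma wgenD u v : wgen (u + v) = wgen u + wgen v.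
Proof. by rewrite [RHS]waddE; apply/wpiP; exact: weq_WVD. Qed.

Lemma wgenZ (r : R) v : wgen (r *: v) = r%:C *: wgen v.
Proof. by rewrite wscaleE [RHS]wmulE; apply/wpiP; exact: weq_WVZ. Qed.

Lemma wgen0 : wgen 0 = 0.
Proof. by rewrite -(scale0r 0) wgenZ scale0r. Qed.

Lemma hbarC a : hbar * a = a * hbar.
Proof.
by elim/wE: a => s; rewrite [LHS]wmulE [RHS]wmulE; apply/wpiP; exact: weq_hC.
Qed.

Lemma hbar_hbarV : hbar * hbarV = 1.
Proof. by rewrite [LHS]wmulE; apply/wpiP; exact: weq_hinv. Qed.

Lemma hbarV_hbar : hbarV * hbar = 1.
Proof. by rewrite -hbarC hbar_hbarV. Qed.

(** The presentation only makes [hbar] central; the inverse of a central element is central. *)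
Lemma hbarVC a : hbarV * a = a * hbarV.
Proof.
by rewrite -[LHS]mulr1 -hbar_hbarV !mulrA -[hbarV * a * hbar]mulrA
  -hbarC mulrA hbarV_hbar mul1r.
Qed.

Lemma wgen_commutator u v :
  wgen u * wgen v - wgen v * wgen u = ('i * (w u v)%:C) *: hbar.
Proof.
apply/eqP; rewrite subr_eq addrC; apply/eqP.
rewrite wscaleE [wgen u * _]wmulE [wgen v * _]wmulE [wconst _ * _]wmulE [RHS]waddE.
by apply/wpiP; exact: weq_comm.
Qed.

End WeylAlgebraTheory.

(** * The number operator *)

Section NumberOperator.
Variables (K : numFieldType) (A : lmodType K) (n : nat).
Variables (d y : 'I_n -> {linear A -> A}).
Hypothesis dC : forall i j a, d i (d j a) = d j (d i a).
Hypothesis dy : forall i j a, d i (y j a) = y j (d i a) - (i == j)%:R *: a.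

(** The contracting homotopy of the Koszul complex on one-forms; the minus sign compensates that of
    [dy]. *)
Definition codiff (th : 'I_n -> A) : A := - \sum_i y i (th i).
Definition Nop (a : A) : A := codiff (fun i => d i a).

(** Moving [d j] past [y j] produces [th j]; closedness turns the remaining sum into the number
    operator. *)
Lemma d_codiff th j : (forall i, d j (th i) = d i (th j)) ->
  d j (codiff th) = th j + Nop (th j).
Proof.
move=> dth; rewrite /codiff linearN linear_sum /= /Nop /codiff.
under eq_bigr do rewrite dy dth.
rewrite sumrB opprB; congr (_ + _).
rewrite (bigD1 j) //= eqxx scale1r big1 ?addr0 // => i.
by rewrite eq_sym => /negPf->; rewrite scale0r.
Qed.

Lemma NopZ c a : Nop (c *: a) = c *: Nop a.
Proof.
rewrite /Nop /codiff scalerN scaler_sumr; congr (- _).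
by apply: eq_bigr => i _; rewrite !linearZ.
Qed.

(** This is [d_codiff] for the exact form with components [d i a], which is closed because the [d i]
    commute. *)
Lemma d_Nop i a : d i (Nop a) = Nop (d i a) + d i a.
Proof. by rewrite d_codiff 1?addrC // => j; exact: dC. Qed.

(** The product [(N - s)(N - s - 1) .. (N - s - m + 1)]. The offset is a parameter because it drops
    by one when some [d i] passes. *)
Fixpoint Nprod m s (a : A) : A :=
  if m is m'.+1 then Nop (Nprod m' s.+1 a) - s%:R *: Nprod m' s.+1 a else a.

Lemma NprodZ m s c a : Nprod m s (c *: a) = c *: Nprod m s a.
Proof.
elim: m s => //= m IH s.
by rewrite IH NopZ scalerBr !scalerA mulrC.
Qed.

Lemma Nprod_recr m s a :
  Nprod m.+1 s a = Nprod m s (Nop a - (s + m)%:R *: a).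
Proof.
elim: m s a => [|m IH] s a; first by rewrite /= addn0.
by rewrite [LHS]/= -[Nop (Nprod m _ _) - _]/(Nprod m.+1 s.+1 a) IH addSnnS.
Qed.

Lemma d_Nprod m s i a : d i (Nprod m s.+1 a) = Nprod m s (d i a).
Proof.
elim: m s => //= m IH s.
rewrite linearB linearZ /= d_Nop !IH -addrA; congr (_ + _).
by rewrite -{1}[Nprod m s.+1 _]scale1r -scalerBl -opprB scaleNr mulrSr addrK.
Qed.

(** Stands in for degree at most [k], which has no meaning in an abstract module: all derivatives of
    order [k + 1] vanish. *)
Fixpoint dnil k (a : A) : Prop :=
  if k is k'.+1 then forall i, dnil k' (d i a) else forall i, d i a = 0.

(** The outermost factor is [N], which starts by applying the [d i]. Moving [d i] inwards turns the
    other factors into the product for [d i a], which vanishes by induction. *)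
Lemma Nprod_dnil k a : dnil k a -> Nprod k.+1 0 a = 0.
Proof.
elim: k a => [|k IH] a /= da.
  by rewrite scale0r subr0 /Nop /codiff big1 ?oppr0 // => i _; rewrite da linear0.
rewrite scale0r subr0 -[Nop (Nprod k _ _) - _]/(Nprod k.+1 1 a) {1}/Nop /codiff.
by rewrite big1 ?oppr0 // => i _; rewrite d_Nprod IH ?linear0.
Qed.

End NumberOperator.

(** * Formal series *)

Section SeriesTheory.
Variable A : pzRingType.
Implicit Types a b c u : nat -> A.

Lemma sum_triangle (F : nat -> nat -> A) k :
  \sum_(i < k.+1) \sum_(j < (k - i).+1) F i j =
  \sum_(m < k.+1) \sum_(i < m.+1) F i (m - i)%N.
Proof.
elim: k => [|k IH]; first by rewrite !(big_ord_recl, big_ord0, addr0).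
rewrite [RHS]big_ord_recr /= -IH [LHS]big_ord_recr /=.
rewrite [X in _ = _ + X]big_ord_recr /= subnn.
rewrite big_ord1 addrA -big_split; congr (_ + _); apply: eq_bigr => i _ /=.
by rewrite subSn ?big_ord_recr // -ltnS.
Qed.

Lemma smulA a b c : smul a (smul b c) = smul (smul a b) c.
Proof.
apply/funext => k; rewrite /smul.
transitivity (\sum_(i < k.+1) \sum_(j < (k - i).+1) a i * b j * c (k - (i + j))%N).
  apply: eq_bigr => i _; rewrite mulr_sumr; apply: eq_bigr => j _.
  by rewrite mulrA subnDA.
rewrite (sum_triangle (fun i j => a i * b j * c (k - (i + j))%N)).
apply: eq_bigr => m _; rewrite mulr_suml; apply: eq_bigr => i _.
by rewrite subnKC // -ltnS.
Qed.

Lemma smul1s a : smul (sone A) a = a.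
Proof.
apply/funext => k; rewrite /smul big_ord_recl /sone /= mul1r subn0 big1 ?addr0 //.
by move=> i _; rewrite mul0r.
Qed.

Lemma smuls1 a : smul a (sone A) = a.
Proof.
apply/funext => k; rewrite /smul big_ord_recr /sone /= subnn mulr1 big1 ?add0r //.
by move=> i _; rewrite subn_eq0 leqNgt ltn_ord mulr0.
Qed.

Lemma smulMnr a b m : smul a (b *+ m) = smul a b *+ m.
Proof.
elim: m => [|m IH].
  by rewrite !mulr0n; apply/funext => k; rewrite /smul big1 // => i _; exact: mulr0.
rewrite !mulrS -IH; apply/funext => k.
rewrite -[RHS]/(smul a b k + smul a (b *+ m) k) /smul -big_split.
by apply: eq_bigr => i _; exact: mulrDr.
Qed.

(** The mixed products [a c b] cancel. The expanded form is the one in which [cov_smul] meets the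
    brackets with the [A_i]. *)
Lemma scomm_leibniz c a b k :
  smul c (smul a b) k - smul (smul a b) c k =
  \sum_(i < k.+1) (smul c a i * b (k - i)%N - smul a c i * b (k - i)%N) +
  \sum_(i < k.+1) (a i * smul c b (k - i)%N - a i * smul b c (k - i)%N).
Proof.
transitivity (smul (smul c a) b k - smul (smul a c) b k +
  (smul a (smul c b) k - smul a (smul b c) k)); last by rewrite !sumrB.
by rewrite !smulA addrA subrK.
Qed.

Lemma spowS a j : spow a j.+1 = smul a (spow a j). Proof. by []. Qed.

Lemma spowSr a j : spow a j.+1 = smul (spow a j) a.
Proof.
elim: j => [|j IH]; first by rewrite spowS smul1s smuls1.
by rewrite spowS {1}IH smulA -spowS.
Qed.

Lemma spow_small u j k : u 0%N = 0 -> (k < j)%N -> spow u j k = 0.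
Proof.
move=> u0; elim: j k => // j IH k kj; rewrite spowS /smul big_ord_recl u0 mul0r.
rewrite add0r big1 // => i _; rewrite IH ?mulr0 //.
case: k kj i => [|k] kj i; first by case: i.
by rewrite lift0 subSS; exact: (@leq_ltn_trans k _ j (leq_subr _ _) kj).
Qed.

Definition sgeom u : nat -> A := fun k => \sum_(j < k.+1) spow u j k.

(** A bound [N] common to all degrees allows the summations over powers and over degrees to be
    exchanged. *)
Lemma sum_spow_widen u (f : nat -> A) k N : u 0%N = 0 -> (k < N)%N ->
  \sum_(j < k.+1) f j * spow u j k = \sum_(j < N) f j * spow u j k.
Proof.
move=> u0 kN; rewrite (big_ord_widen N (fun j => f j * spow u j k)) //.
rewrite [RHS](bigID (fun j : 'I_N => (j < k.+1)%N)) /= [X in _ + X]big1 ?addr0 //.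
by move=> j; rewrite -leqNgt => kj; rewrite spow_small ?mulr0.
Qed.

Lemma sgeom_widen u k N : u 0%N = 0 -> (k < N)%N ->
  sgeom u k = \sum_(j < N) spow u j k.
Proof.
move=> u0 kN; rewrite /sgeom; have := sum_spow_widen (fun=> 1) u0 kN.
by under eq_bigr do rewrite mul1r; under [in RHS]eq_bigr do rewrite mul1r.
Qed.

(** Multiplying the geometric series of [u = 1 - a] by [1 - u] telescopes, and the remaining power
    [u ^ (k + 1)] has no component of degree [k]. *)
Lemma smul_geom a : a 0%N = 1 ->
  smul (sgeom (sone A - a)) a = sone A /\ smul a (sgeom (sone A - a)) = sone A.
Proof.
move=> a0; set u := sone A - a.
have u0 : u 0%N = 0 by rewrite /u !fctE /sone a0 subrr.
have -> : a = sone A - u by rewrite /u opprB addrCA subrr addr0.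
have tele k : \sum_(j < k.+1) (spow u j k - spow u j.+1 k) = sone A k.
  rewrite sumrB -opprB; apply/eqP; rewrite eqr_oppLR; apply/eqP.
  have H := telescope_sumr (spow u ^~ k) (leq0n k.+1).
  rewrite big_mkord sumrB in H.
  by rewrite H (spow_small u0) // sub0r.
split; apply/funext => k; rewrite -[RHS]tele.
  transitivity (\sum_(i < k.+1) \sum_(j < k.+1) spow u j i * (sone A - u) (k - i)%N).
    rewrite /smul; apply: eq_bigr => i _; rewrite -mulr_suml; congr (_ * _).
    exact: sgeom_widen.
  rewrite exchange_big; apply: eq_bigr => j _.
  rewrite spowSr -{2}[spow u j]smuls1 /smul -sumrB; apply: eq_bigr => i _.
  by rewrite -mulrBr.
transitivity (\sum_(i < k.+1) \sum_(j < k.+1) (sone A - u) i * spow u j (k - i)%N).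
  rewrite /smul; apply: eq_bigr => i _; rewrite -mulr_sumr; congr (_ * _).
  by apply: sgeom_widen; rewrite // ltnS leq_subr.
rewrite exchange_big; apply: eq_bigr => j _.
rewrite spowS -{2}[spow u j]smul1s /smul -sumrB; apply: eq_bigr => i _.
by rewrite -mulrBl.
Qed.

(** [sinv] picks some two-sided inverse; uniqueness of inverses identifies it with the geometric
    series, whose smoothness can be checked. *)
Lemma sinvE a : a 0%N = 1 -> sinv a = sgeom (sone A - a).
Proof.
move=> /smul_geom; set b := sgeom _ => -[ba ab].
have : (fun c => smul c a = sone A /\ smul a c = sone A) (sinv a).
  by rewrite /sinv; case: xgetP => [c -> //|/(_ b)]; case.
by case=> ca _; rewrite -[sinv a]smuls1 -ab smulA ca smul1s.
Qed.

Lemma smulVs a : a 0%N = 1 -> smul (sinv a) a = sone A.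
Proof. by move=> a0; rewrite sinvE //; case: (smul_geom a0). Qed.

End SeriesTheory.

(** * Smooth functions and coframes on manifolds *)

Section ManifoldCalculus.
Variables (R : realType) (n : nat) (M : manifold R n).
Implicit Types (c d : chart R n M) (U : set M) (x y : M).

Lemma chart_at_atlas x : atlas (chart_at x).
Proof. exact: s2valP (cid2 (atlas_cover x)). Qed.

Lemma chart_at_dom x : cdom (chart_at x) x.
Proof. exact: s2valP' (cid2 (atlas_cover x)). Qed.

Lemma cdom_open c : atlas c -> open (cdom c).
Proof. by move=> /atlas_chart[]. Qed.

Lemma coordK c y : atlas c -> cdom c y -> param c (coord c y) = y.
Proof. by move=> /atlas_chart[_ _ + _ _]; apply. Qed.

(** Near a point of the image, the image is the preimage of [U] under the continuous map
    [param c]. *)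
Lemma image_open c U : atlas c -> open U -> open (coord c @` (cdom c `&` U)).
Proof.
move=> /atlas_chart[_ oI pK _ cp] oU.
move: cp; rewrite continuous_open_subspace // => cp.
rewrite openE => z [y [cy Uy] <-].
have Iz : (coord c @` cdom c) (coord c y) by exists y.
have : nbhs (coord c y) (param c @^-1` U).
  by apply: cp; [rewrite inE|rewrite pK //; exact: open_nbhs_nbhs].
have : nbhs (coord c y) (coord c @` cdom c) by exact: open_nbhs_nbhs.
move=> nI nU; rewrite /interior; apply: filterS (filterI nI nU).
move=> _ [[y' cy' <-]]; rewrite /= pK // => Uy'; by exists y'.
Qed.

Lemma smooth_funP U f c k : atlas c -> smooth_fun U f ->
  Ck k (coord c @` (cdom c `&` U)) (fun z => f (param c z)).
Proof. by move=> ac /(_ c ac) /smooth_onE; exact. Qed.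
Arguments smooth_funP {U f c} k _ _ [s] _ [x] _.

Lemma smooth_fun_subset U U' f : U' `<=` U -> smooth_fun U f -> smooth_fun U' f.
Proof.
move=> U'U fs c ac; apply/smooth_onE => k.
apply: Ck_subset (smooth_funP k ac fs).
by move=> _ [y [cy U'y] <-]; exists y => //; split=> //; exact: U'U.
Qed.

Lemma smooth_fun_ext U f g : open U -> (forall x, U x -> f x = g x) ->
  smooth_fun U f -> smooth_fun U g.
Proof.
move=> oU fg fs c ac; apply/smooth_onE => k.
apply: (Ck_ext (image_open ac oU)) (smooth_funP k ac fs).
by move=> _ [y [cy Uy] <-]; rewrite coordK //; exact: fg.
Qed.

Lemma smooth_fun_cst U (r : R) : open U -> smooth_fun U (fun=> r).
Proof.
move=> oU c ac; apply/smooth_onE => k; apply: Ck_cst; exact: image_open.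
Qed.

Lemma smooth_funN U f : open U -> smooth_fun U f ->
  smooth_fun U (fun x => - f x).
Proof.
move=> oU fs c ac; have oI := image_open ac oU; apply/smooth_onE => k.
apply: (Ck_ext oI _ (Ck_mul oI (Ck_cst (-1) oI) (smooth_funP k ac fs))) => z _.
exact: mulN1r.
Qed.

Lemma transition_Ck c d k i : atlas c -> atlas d ->
  Ck k (coord c @` (cdom c `&` cdom d)) (fun z => coord d (param c z) 0 i).
Proof. by move=> ac ad; have /smooth_onE := atlas_smooth ac ad i; exact. Qed.
Arguments transition_Ck {c d} k i _ _ [s] _ [x] _.

Lemma transition_differentiable c d y : atlas c -> atlas d ->
  cdom c y -> cdom d y ->
  differentiable (fun z => coord d (param c z)) (coord c y).
Proof.
move=> ac ad cy dy; apply: differentiable_rV => j.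
apply: (Ck_differentiable (transition_Ck 0 j ac ad)).
by exists y.
Qed.

(** In any other chart the function is seen through a transition map, which is smooth. *)
Lemma smooth_fun_chart U f c : atlas c -> open U -> U `<=` cdom c ->
  (forall k, Ck k (coord c @` U) (fun z => f (param c z))) -> smooth_fun U f.
Proof.
move=> ac oU Uc fk d ad; apply/smooth_onE => k.
have oI : open (coord c @` U).
  by rewrite -(setIidr Uc); exact: image_open.
apply: (Ck_ext (image_open ad oU) (f := fun z => f (param c (coord c (param d z))))).
  by move=> _ [y [dy Uy] <-]; rewrite coordK // coordK //; exact: Uc.
apply: (Ck_comp (image_open ad oU) oI (f := fun z => coord c (param d z))) (fk k).
  by move=> _ [y [dy Uy] <-]; rewrite coordK //; exists y.
move=> j; apply: Ck_subset (transition_Ck k j ad ac).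
by move=> _ [y [dy Uy] <-]; exists y => //; split=> //; exact: Uc.
Qed.

Lemma near_param c y U (P : 'rV[R]_n -> Prop) : atlas c -> open U -> U y ->
  cdom c y -> (forall y', cdom c y' -> U y' -> P (coord c y')) ->
  \forall z \near coord c y, P z.
Proof.
move=> ac oU Uy cy UP; apply: (open_near (image_open ac oU)); first by exists y.
by move=> _ [y' [cy' Uy'] <-]; exact: UP.
Qed.

Lemma smooth_fun_differentiable U f c y : atlas c -> open U -> smooth_fun U f ->
  U y -> cdom c y -> differentiable (fun z => f (param c z)) (coord c y).
Proof.
move=> ac oU fs Uy cy; apply: (Ck_differentiable (smooth_funP 0 ac fs)).
by exists y.
Qed.

(** The tangent space at [x] is modelled on [chart_at x], and the change of coordinates from this
    chart to itself is the identity near [coord (chart_at x) x]. *)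
Lemma cfield_chart_at x (v : tangent x) : cfield (chart_at x) v x = v.
Proof.
rewrite /cfield; have := near_param
  (P := fun z => coord (chart_at x) (param (chart_at x) z) = z)
  (chart_at_atlas x) openT I (chart_at_dom x).
move=> H; rewrite (near_eq_derive (g := id) v (H _)) ?derive_id //.
by move=> y' cy' _; rewrite coordK //; exact: chart_at_atlas.
Qed.

Lemma tdiff_cfield U f c v y : atlas c -> open U -> smooth_fun U f ->
  U y -> cdom c y ->
  tdiff f (cfield c v y) = 'D_v (fun z => f (param c z)) (coord c y).
Proof.
move=> ac oU fs Uy cy; rewrite /tdiff /cfield.
set e := chart_at y; have ae : atlas e by exact: chart_at_atlas.
have ey : cdom e y by exact: chart_at_dom.
have dt := transition_differentiable ac ae cy ey.
have df : differentiable (fun z => f (param e z)) (coord e (param c (coord c y))).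
  by rewrite coordK //; exact: smooth_fun_differentiable fs _ _.
have := derive_comp v dt df; rewrite coordK // => <-.
apply: near_eq_derive.
apply: (near_param ac (cdom_open ae) ey cy) => y' cy' ey'.
by rewrite /= coordK // coordK.
Qed.

Lemma tdiff_smooth U f c i : atlas c -> open U -> smooth_fun U f ->
  smooth_fun (U `&` cdom c) (fun y => tdiff f (cfield c (delta_mx 0 i) y)).
Proof.
move=> ac oU fs; have oUc := openI oU (cdom_open ac).
apply: (smooth_fun_chart ac oUc) => [y []//|k].
have oI := image_open ac oU.
rewrite setIC.
apply: (Ck_ext oI (f := partial i (fun z => f (param c z)))).
  by move=> _ [y [cy Uy] <-]; rewrite coordK // (tdiff_cfield _ ac oU fs Uy cy).
have /CkS[_] := smooth_funP k.+1 ac fs; exact.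
Qed.

Lemma tdiff_cst x (r : R) (v : tangent x) : tdiff (fun=> r) v = 0.
Proof. exact: derive_cst. Qed.

(** The differential of the [i]-th coordinate of [c], in the basis of [chart_at x]; these covectors
    form the coframe dual to the fields [cfield c]. *)
Definition ccov c (i : 'I_n) x : cotangent x :=
  \col_j tdiff (fun y => coord c y 0 i) (delta_mx 0 j : tangent x).

Lemma coord_smooth c i : atlas c -> smooth_fun (cdom c) (fun y => coord c y 0 i).
Proof.
move=> ac d ad; apply/smooth_onE => k.
exact: (transition_Ck k i ad ac).
Qed.

Lemma pairing_ccov c i x (v : tangent x) : atlas c -> cdom c x ->
  pairing (ccov c i x) v = tdiff (fun y => coord c y 0 i) v.
Proof.
move=> ac cx; have df := smooth_fun_differentiable (chart_at_atlas x)
  (cdom_open ac) (coord_smooth i ac) cx (chart_at_dom x).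
rewrite /pairing mxE [RHS](derive_partial _ df); apply: eq_bigr => j _.
by rewrite mxE.
Qed.

Lemma ccov_smooth c i : atlas c -> smooth_cov (cdom c) (ccov c i).
Proof.
move=> ac d ad j.
have oI := openI (cdom_open ac) (cdom_open ad).
apply: (smooth_fun_ext oI) (tdiff_smooth j ad (cdom_open ac) (coord_smooth i ac)).
by move=> y [cy dy]; rewrite pairing_ccov.
Qed.

Lemma pairing_ccov_cfield c i y (v : 'rV[R]_n) : atlas c -> cdom c y ->
  pairing (ccov c i y) (cfield c v y) = v 0 i.
Proof.
move=> ac cy; rewrite pairing_ccov //.
rewrite (tdiff_cfield _ ac (cdom_open ac) (coord_smooth i ac)) //.
have dc : differentiable (fun z : 'rV[R]_n => z) (coord c y).
  exact: ex_diff.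
have := derive_coord v i dc; rewrite derive_id => ->.
apply: near_eq_derive.
apply: (near_param ac openT I cy) => y' cy' _.
by rewrite coordK.
Qed.

(* Rows: the frame of [c] at [y]; columns: the dual coframe. *)
Definition frame c y : 'M[R]_n := \matrix_i (cfield c (delta_mx 0 i) y : 'rV[R]_n).
Definition coframe c y : 'M[R]_n := \matrix_(j, i) (ccov c i y : 'cV[R]_n) j 0.

Lemma frame_coframe c y : atlas c -> cdom c y -> frame c y *m coframe c y = 1%:M.
Proof.
move=> ac cy; apply/matrixP => i j.
have := pairing_ccov_cfield j (delta_mx 0 i) ac cy.
rewrite !mxE /pairing mxE eqxx /= [_ == j]eq_sym eq_sym => <-.
by apply: eq_bigr => k _; rewrite !mxE.
Qed.

Lemma coframe_frame c y : atlas c -> cdom c y -> coframe c y *m frame c y = 1%:M.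
Proof. by move=> ac cy; apply/mulmx1C/frame_coframe. Qed.

Lemma frame_unit c y : atlas c -> cdom c y -> frame c y \in unitmx.
Proof. by move=> ac cy; have [] := mulmx1_unit (frame_coframe ac cy). Qed.

End ManifoldCalculus.
Arguments smooth_funP {R n M U f c} k _ _ [s] _ [x] _.

(** * Smooth sections of the Weyl bundle *)

Section WeylBundle.
Variables (R : realType) (n : nat) (M : manifold R n) (om : symplectic_form M).
Implicit Types (c d : chart R n M) (U : set M) (x y : M).
Local Notation wfib := (wfib om).
Local Notation wsec := (wsec om).
Local Notation wsmooth := (@wsmooth R n M om).
Local Notation wgenerated := (@wgenerated R n M om).
Local Notation wconst x := (wconst (@omega_bar R n M om x)).
Local Notation wgen x := (wgen (@omega_bar R n M om x)).
Local Notation hbar x := (hbar (@omega_bar R n M om x) : wfib x).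
Local Notation hbarV x := (hbarV (@omega_bar R n M om x) : wfib x).

Lemma smooth_cfun_subset U U' (f : M -> R[i]) : U' `<=` U ->
  smooth_cfun U f -> smooth_cfun U' f.
Proof. by move=> U'U [fr fi]; split; exact: smooth_fun_subset U'U _. Qed.

Lemma smooth_cfun_cst U (z : R[i]) : open U -> smooth_cfun U (fun _ : M => z).
Proof. by move=> oU; split; exact: smooth_fun_cst. Qed.

Lemma smooth_cov_subset U U' xi : U' `<=` U -> smooth_cov U xi -> smooth_cov U' xi.
Proof.
move=> U'U xs c ac i; apply: smooth_fun_subset (xs c ac i).
by move=> y [U'y cy]; split=> //; exact: U'U.
Qed.

Lemma smooth_cov0 U : open U -> smooth_cov U (fun x : M => 0 : cotangent x).
Proof.
move=> oU c ac i; have oUc := openI oU (cdom_open ac).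
apply: smooth_fun_ext (oUc) _ (smooth_fun_cst 0 oUc) => y _.
by rewrite /pairing mulmx0 mxE.
Qed.

Lemma wgenerated_subset h U U' k a : U' `<=` U -> wgenerated h U k a ->
  wgenerated h U' k a.
Proof.
move=> U'U; elim=> [f fs|xi xs||hh|{}k {}a b _ ? _ ?|{}k l {}a b _ ? _ ?].
- by apply: wgenerated_fun; exact: smooth_cfun_subset U'U _.
- by apply: wgenerated_cov; exact: smooth_cov_subset U'U _.
- exact: wgenerated_hbar.
- exact: wgenerated_hbarV.
- exact: wgenerated_add.
- exact: wgenerated_mul.
Qed.

Lemma wgenerated_hinv U k a : wgenerated false U k a -> wgenerated true U k a.
Proof.
elim=> [f fs|xi xs||//|{}k {}a b _ ? _ ?|{}k l {}a b _ ? _ ?].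
- exact: wgenerated_fun.
- exact: wgenerated_cov.
- exact: wgenerated_hbar.
- exact: wgenerated_add.
- exact: wgenerated_mul.
Qed.

Lemma wgenerated_ge0 U k a : wgenerated false U k a -> 0 <= k.
Proof. by elim=> // {}k l ? ? _ k0 _ l0; exact: addr_ge0. Qed.

Lemma wsmooth_generated h U k a : open U -> wgenerated h U k a -> wsmooth h k U a.
Proof. by move=> oU ga x Ux; exists U; split=> //; exists a. Qed.

Lemma wsmooth_hinv U k a : wsmooth false k U a -> wsmooth true k U a.
Proof.
move=> sa x /sa [V [oV Vx [b gb ab]]]; exists V; split=> //.
by exists b => //; exact: wgenerated_hinv.
Qed.

Lemma wsmooth_subset h U U' k a : U' `<=` U -> wsmooth h k U a -> wsmooth h k U' a.
Proof. by move=> U'U sa x /U'U /sa. Qed.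

Lemma wsmooth_ext h U k a b : open U -> (forall x, U x -> a x = b x) ->
  wsmooth h k U a -> wsmooth h k U b.
Proof.
move=> oU ab sa x Ux; have [V [oV Vx [a' ga aa']]] := sa _ Ux.
exists (V `&` U); split; [exact: openI|by []|exists a'].
  by apply: wgenerated_subset ga => y [].
by move=> y [Vy Uy]; rewrite -ab // aa'.
Qed.

Lemma wsmooth_local h U k a :
  (forall x, U x -> exists2 V, V x & wsmooth h k V a) -> wsmooth h k U a.
Proof. by move=> H x /H [V Vx sa]; exact: sa. Qed.

Lemma wsmooth_charts h U k a :
  (forall c, atlas c -> wsmooth h k (U `&` cdom c) a) -> wsmooth h k U a.
Proof.
move=> H; apply: wsmooth_local => x Ux.
have [c ac cx] := atlas_cover x.
by exists (U `&` cdom c) => //; exact: H.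
Qed.

Lemma wsmooth_add h U k (a b : wsec) : wsmooth h k U a -> wsmooth h k U b ->
  wsmooth h k U (fun x => a x + b x).
Proof.
move=> sa sb x Ux; have [V [oV Vx [a' ga aa']]] := sa _ Ux.
have [W [oW Wx [b' gb bb']]] := sb _ Ux.
exists (V `&` W); split; [exact: openI|by []|exists (fun x => a' x + b' x)].
  apply: wgenerated_add; first by apply: wgenerated_subset ga => y [].
  by apply: wgenerated_subset gb => y [].
by move=> y [Vy Wy]; rewrite aa' // bb'.
Qed.

Lemma wsmooth_mul h U k l (a b : wsec) : wsmooth h k U a -> wsmooth h l U b ->
  wsmooth h (k + l) U (fun x => a x * b x).
Proof.
move=> sa sb x Ux; have [V [oV Vx [a' ga aa']]] := sa _ Ux.
have [W [oW Wx [b' gb bb']]] := sb _ Ux.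
exists (V `&` W); split; [exact: openI|by []|exists (fun x => a' x * b' x)].
  apply: wgenerated_mul; first by apply: wgenerated_subset ga => y [].
  by apply: wgenerated_subset gb => y [].
by move=> y [Vy Wy]; rewrite aa' // bb'.
Qed.

Lemma wsmooth_fun h U f : open U -> smooth_cfun U f ->
  wsmooth h 0 U (fun x => wconst x (f x) : wfib x).
Proof. by move=> oU fs; apply: wsmooth_generated => //; exact: wgenerated_fun. Qed.

Lemma wsmooth_cst h U z : open U -> wsmooth h 0 U (fun x => wconst x z : wfib x).
Proof. by move=> oU; apply: wsmooth_fun => //; exact: smooth_cfun_cst. Qed.

Lemma wsmooth_cov h U xi : open U -> smooth_cov U xi ->
  wsmooth h 1 U (fun x => wgen x (xi x) : wfib x).
Proof. by move=> oU fs; apply: wsmooth_generated => //; exact: wgenerated_cov. Qed.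

Lemma wsmooth_hbar h U : open U -> wsmooth h 2 U (fun x => hbar x).
Proof. by move=> oU; apply: wsmooth_generated => //; exact: wgenerated_hbar. Qed.

Lemma wsmooth_scale h U k z (a : wsec) : open U -> wsmooth h k U a ->
  wsmooth h k U (fun x => z *: a x).
Proof.
by move=> oU sa; have := wsmooth_mul (wsmooth_cst h z oU) sa; rewrite add0r.
Qed.

Lemma wsmooth_opp h U k (a : wsec) : open U -> wsmooth h k U a ->
  wsmooth h k U (fun x => - a x).
Proof.
move=> oU sa; apply: wsmooth_ext (oU) _ (wsmooth_scale (-1) oU sa) => x _.
by rewrite scaleN1r.
Qed.

Lemma wsmooth_sub h U k (a b : wsec) : open U -> wsmooth h k U a -> wsmooth h k U b ->
  wsmooth h k U (fun x => a x - b x).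
Proof. by move=> oU sa sb; apply: wsmooth_add => //; exact: wsmooth_opp. Qed.

(** Degree is a property of expressions, so zero is raised in degree by multiplying it with the zero
    covector field. *)
Lemma wsmooth0 h U (k : nat) : open U -> wsmooth h k%:Z U (fun x => 0 : wfib x).
Proof.
move=> oU; elim: k => [|k IH]; first exact: wsmooth_cst.
have := wsmooth_mul IH (wsmooth_cov h oU (smooth_cov0 oU)).
rewrite (_ : k%:Z + 1 = k.+1) ?intS 1?addrC //.
by apply: wsmooth_ext => // x _; rewrite mul0r.
Qed.

Lemma wsmooth_sum h U (k : nat) m (a : 'I_m -> wsec) : open U ->
  (forall i, wsmooth h k%:Z U (a i)) -> wsmooth h k%:Z U (fun x => \sum_(i < m) a i x).
Proof.
move=> oU; elim: m a => [|m IH] a sa.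
  apply: wsmooth_ext (oU) _ (wsmooth0 h k oU) => x _; by rewrite big_ord0.
apply: wsmooth_ext (oU) _ (wsmooth_add (sa ord0) (IH (fun i => a (lift ord0 i)) _)) => //.
by move=> x _; rewrite big_ord_recl.
Qed.

(* The components of negative degree vanish. *)
Definition wsm (k : int) U (a : wsec) : Prop :=
  if 0 <= k then wsmooth false k U a else forall x, U x -> a x = 0.

Lemma wsm_nat (k : nat) U a : wsm k%:Z U a = wsmooth false k%:Z U a.
Proof. by []. Qed.

Lemma wsm_zero k U (a : wsec) : open U -> (forall x, U x -> a x = 0) -> wsm k U a.
Proof.
move=> oU a0; rewrite /wsm; case: k => k //=.
by apply: wsmooth_ext (oU) _ (wsmooth0 false k oU) => x Ux; rewrite a0.
Qed.

Lemma wsm_generated U k a : open U -> wgenerated false U k a -> wsm k U a.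
Proof.
by move=> oU ga; rewrite /wsm (wgenerated_ge0 ga); exact: wsmooth_generated.
Qed.

Lemma wsm_ext U k a b : open U -> (forall x, U x -> a x = b x) ->
  wsm k U a -> wsm k U b.
Proof.
move=> oU ab; rewrite /wsm; case: ifP => _; first exact: wsmooth_ext.
by move=> a0 x Ux; rewrite -ab // a0.
Qed.

Lemma wsm_subset U U' k a : U' `<=` U -> wsm k U a -> wsm k U' a.
Proof.
move=> U'U; rewrite /wsm; case: ifP => _; first exact: wsmooth_subset.
by move=> a0 x /U'U; exact: a0.
Qed.

Lemma wsm_local U k a : (forall x, U x -> exists2 V, V x & wsm k V a) -> wsm k U a.
Proof.
rewrite /wsm; case: ifP => _; first exact: wsmooth_local.
by move=> H x /H [V Vx a0]; exact: a0.
Qed.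

Lemma wsm_add U k (a b : wsec) : wsm k U a -> wsm k U b -> wsm k U (fun x => a x + b x).
Proof.
rewrite /wsm; case: ifP => _; first exact: wsmooth_add.
by move=> a0 b0 x Ux; rewrite a0 // b0 // addr0.
Qed.

Lemma wsm_mul U k l (a b : wsec) : open U -> wsm k U a -> wsm l U b ->
  wsm (k + l) U (fun x => a x * b x).
Proof.
move=> oU; rewrite {1 2}/wsm; case: ifP => k0; last first.
  by move=> a0 _; apply: wsm_zero => // x Ux; rewrite a0 // mul0r.
case: ifP => l0 sa; last first.
  by move=> b0; apply: wsm_zero => // x Ux; rewrite b0 // mulr0.
by move=> sb; rewrite /wsm addr_ge0 //; exact: wsmooth_mul.
Qed.

(** * Commutators in a fibre and the operator [[A_{-1}, -]] *)

Section FibreCommutators.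
Variable x : M.
Implicit Types (a b : wfib x) (u v : tangent x) (xi : cotangent x).

Lemma wcommE a b : wcomm a b = a * b - b * a. Proof. by []. Qed.

Lemma wcomm0 a : wcomm a 0 = 0.
Proof. by rewrite wcommE mulr0 mul0r subrr. Qed.

Lemma wcommDr a b b' : wcomm a (b + b') = wcomm a b + wcomm a b'.
Proof. by rewrite !wcommE mulrDr mulrDl opprD addrACA. Qed.

Lemma wcommDl a a' b : wcomm (a + a') b = wcomm a b + wcomm a' b.
Proof. by rewrite !wcommE mulrDr mulrDl opprD addrACA. Qed.

Lemma wcommNr a b : wcomm a (- b) = - wcomm a b.
Proof. by rewrite !wcommE mulrN mulNr opprB opprK addrC. Qed.

Lemma wcommZl z a b : wcomm (z *: a) b = z *: wcomm a b.
Proof. by rewrite !wcommE [z *: a * b]wscaleAl [b * _]wscaleAr -scalerBr. Qed.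

Lemma wcommZr z a b : wcomm a (z *: b) = z *: wcomm a b.
Proof. by rewrite !wcommE [z *: b * a]wscaleAl [a * _]wscaleAr -scalerBr. Qed.

Lemma wcommMr a b b' : wcomm a (b * b') = wcomm a b * b' + b * wcomm a b'.
Proof. by rewrite !wcommE mulrBl mulrBr !mulrA addrA subrK. Qed.

Lemma wcommMl a a' b : wcomm (a * a') b = a * wcomm a' b + wcomm a b * a'.
Proof. by rewrite !wcommE mulrBl mulrBr !mulrA addrA subrK. Qed.

Lemma wcomm_const a z : wcomm a (wconst x z : wfib x) = 0.
Proof. by rewrite wcommE [X in _ - X]wconstC subrr. Qed.

Lemma wcomm_hbar a : wcomm a (hbar x) = 0.
Proof. by rewrite wcommE [hbar x * a]hbarC subrr. Qed.

Lemma wcomm_hbarX a m : wcomm a (hbar x ^+ m) = 0.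
Proof.
elim: m => [|m IH]; first by rewrite expr0 -[1]/(wconst x 1) wcomm_const.
by rewrite exprS wcommMr IH wcomm_hbar mulr0 mul0r addr0.
Qed.

Lemma wcommC a b : wcomm a b = - wcomm b a.
Proof. by rewrite !wcommE opprB. Qed.

Lemma wcomm_hbarVl a b : wcomm (hbarV x * a) b = hbarV x * wcomm a b.
Proof.
by rewrite !wcommE mulrBr !mulrA; congr (_ - _ * _); exact/esym/hbarVC.
Qed.

Lemma jacobi a a' b :
  wcomm a (wcomm a' b) - wcomm a' (wcomm a b) = wcomm (wcomm a a') b.
Proof.
have -> : wcomm a (wcomm a' b) = wcomm a (a' * b) - wcomm a (b * a').
  by rewrite [wcomm a' b]wcommE wcommDr wcommNr.
rewrite !wcommMr [wcomm a' (wcomm a b)]wcommE [RHS]wcommE.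
by rewrite [wcomm a a' * b + _]addrC opprD addrACA [_ - _ + (_ - _)]addrC addrK.
Qed.

End FibreCommutators.

Section FibreDerivation.
Variable x : M.
Implicit Types (a b : wfib x) (u v : tangent x) (xi eta : cotangent x).
Local Notation S := (sgram om x).

Lemma sgram_tr : S^T = - S.
Proof.
have gE u v : gram_form (sgram om) u v =
    ((u : 'rV[R]_n) *m S *m (v : 'rV[R]_n)^T) 0 0 by [].
have anti u v : gram_form (sgram om) u v + gram_form (sgram om) v u = 0.
  have := symplectic_alt om (u + v : tangent x).
  have aE (A B : 'M[R]_1) : (A + B) 0 0 = A 0 0 + B 0 0 by rewrite mxE.
  rewrite gE linearD /= mulmxDl mulmxDr !mulmxDl !aE -!gE !symplectic_alt.
  by rewrite add0r addr0 addrC.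
apply/matrixP => i j.
have gij k l : gram_form (sgram om) (delta_mx 0 k : tangent x)
    (delta_mx 0 l : tangent x) = S k l.
  by rewrite gE -rowE trmx_delta -colE !mxE.
have := anti (delta_mx 0 j) (delta_mx 0 i); rewrite !gij => /eqP.
by rewrite addr_eq0 => /eqP; rewrite !mxE.
Qed.

Lemma invmx_sgram_tr : (invmx S)^T = - invmx S.
Proof.
have H : S *m - (invmx S)^T = 1%:M.
  by rewrite mulmxN -mulNmx -sgram_tr -trmx_mul mulVmx ?trmx1 // symplectic_nondeg.
rewrite -[LHS]opprK; congr (- _).
by rewrite -[LHS]mul1mx -(mulVmx (symplectic_nondeg om x)) -mulmxA H mulmx1.
Qed.

Lemma omega_barE xi eta :
  omega_bar om xi eta = ((xi : 'cV[R]_n)^T *m (invmx S)^T *m (eta : 'cV[R]_n)) 0 0.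
Proof.
rewrite /omega_bar /omega /gram_form /sharp trmx_mul trmxK.
by rewrite !mulmxA mulmxKV ?symplectic_nondeg.
Qed.

(** The sign comes from the antisymmetry of the inverse Gram matrix. Through [del_gen] it becomes
    the sign in [delL_genL]. *)
Lemma omega_bar_flat v xi : omega_bar om (flat om v) xi = - pairing xi v.
Proof.
rewrite omega_barE /flat trmxK invmx_sgram_tr mulmxN mulNmx mxE; congr (- _).
by rewrite mulmxK ?symplectic_nondeg.
Qed.

(** [omega_bar] is computed in the basis of [chart_at x], which may jump with [x]. In the frame of a
    fixed chart all ingredients are functions whose smoothness is known. *)
Lemma omega_bar_frame c xi eta : atlas c -> cdom c x ->
  omega_bar om xi eta = \sum_i \sum_j pairing xi (cfield c (delta_mx 0 i) x) *
    invmx (\matrix_(k, l) gram_form (sgram om) (cfield c (delta_mx 0 k) x)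
       (cfield c (delta_mx 0 l) x)) j i * pairing eta (cfield c (delta_mx 0 j) x).
Proof.
move=> ac cx; set G := \matrix_(k, l) _; set P := frame c x.
have uP : P \in unitmx by exact: frame_unit.
have GE : G = P *m S *m P^T.
  apply/matrixP => i j; rewrite !mxE /gram_form !mxE.
  apply: eq_bigr => k _; rewrite !mxE; congr (_ * _).
  by apply: eq_bigr => l _; rewrite !mxE.
pose X := (invmx P)^T *m invmx S *m invmx P.
have GX : G *m X = 1%:M.
  rewrite GE /X !mulmxA -(mulmxA (P *m S)) -trmx_mul mulVmx // trmx1 mulmx1.
  by rewrite mulmxK ?symplectic_nondeg // mulmxV.
have [uG _] := mulmx1_unit GX.
have -> : invmx G = X by rewrite -[LHS]mulmx1 -GX mulKmx.
have pE (z : cotangent x) i :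
    pairing z (cfield c (delta_mx 0 i) x) = (P *m (z : 'cV[R]_n)) i 0.
  by rewrite /pairing !mxE; apply: eq_bigr => k _; rewrite !mxE.
transitivity (((P *m (xi : 'cV[R]_n))^T *m X^T *m (P *m (eta : 'cV[R]_n))) 0 0).
  rewrite omega_barE /X !trmx_mul trmxK !mulmxA.
  rewrite -[_ *m P^T *m _]mulmxA -[P^T *m _]trmx_mul mulVmx // trmx1 mulmx1.
  by rewrite -[_ *m invmx P *m P]mulmxA mulVmx // mulmx1.
have trE p q (A : 'M[R]_(p, q)) i j : A^T i j = A j i by rewrite mxE.
rewrite exchange_big mxE; apply: eq_bigr => j _; rewrite mxE mulr_suml.
by apply: eq_bigr => i _; rewrite !pE !trE.
Qed.

Definition del v b : wfib x := wcomm (Aminus1 om v) b.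

(** The factor [1 / (i hbar)] of [A_{-1}] cancels the one in the commutation relation, so [del v]
    contracts generators with [v], up to sign. *)
Lemma del_gen v xi : del v (wgen x xi) = - (pairing xi v)%:C *: (1 : wfib x).
Proof.
rewrite /del /Aminus1 wcommZl wcomm_hbarVl.
have -> : wcomm (wgen x (flat om v) : wfib x) (wgen x xi) =
      ('i * (- pairing xi v)%:C) *: hbar x.
  by rewrite wcommE -omega_bar_flat; exact: wgen_commutator.
rewrite [hbarV x * _]wscaleAr [hbarV x * _]hbarV_hbar scalerA mulrA mulVf ?mul1r.
  by rewrite rmorphN.
by rewrite eq_complex /= oner_eq0 andbF.
Qed.

Lemma delD v a b : del v (a + b) = del v a + del v b.
Proof. exact: wcommDr. Qed.

Lemma delZ v z b : del v (z *: b) = z *: del v b.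
Proof. exact: wcommZr. Qed.

Lemma delM v a b : del v (a * b) = del v a * b + a * del v b.
Proof. exact: wcommMr. Qed.

Lemma del0 v : del v 0 = 0. Proof. exact: wcomm0. Qed.

Lemma delN v b : del v (- b) = - del v b. Proof. exact: wcommNr. Qed.

Lemma del_const v z : del v (wconst x z : wfib x) = 0. Proof. exact: wcomm_const. Qed.

Lemma del_hbar v : del v (hbar x) = 0. Proof. exact: wcomm_hbar. Qed.

Lemma Aminus1P (r : R) u v :
  Aminus1 om (r *: u + v) = r%:C *: Aminus1 om u + Aminus1 om v.
Proof.
rewrite /Aminus1 /flat mulmxDl linearD /= -scalemxAl linearZ /=.
rewrite [X in hbarV x * X]wgenD [X in X + _]wgenZ mulrDr scalerDr.
by rewrite [hbarV x * (_ *: _)]wscaleAr !scalerA mulrC.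
Qed.

Lemma delP (r : R) u v b : del (r *: u + v) b = r%:C *: del u b + del v b.
Proof. by rewrite /del Aminus1P wcommDl wcommZl. Qed.

(** By [jacobi] the two orders differ by the bracket with [[A_{-1}(u), A_{-1}(v)]], a scalar
    multiple of the central element [hbarV]. *)
Lemma delC u v b : del u (del v b) = del v (del u b).
Proof.
apply/eqP; rewrite -subr_eq0 /del jacobi.
have -> : wcomm (Aminus1 om u) (Aminus1 om v) =
   ('i^-1 * - (pairing (flat om v) u)%:C) *: (hbarV x : wfib x).
  rewrite {2}/Aminus1 wcommZr wcommMr [wcomm _ (wgen _ _)]del_gen.
  have -> : wcomm (Aminus1 om u) (hbarV x) = 0.
    by rewrite wcommE [hbarV x * _]hbarVC subrr.
  by rewrite mul0r add0r [hbarV x * _]wscaleAr mulr1 scalerA.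
by rewrite wcommZl wcommE [hbarV x * _]hbarVC subrr scaler0.
Qed.

End FibreDerivation.

(** * Smoothness of the operators on sections of the Weyl bundle *)

Lemma omega_bar_smooth U (xi eta : forall x, cotangent x) c : open U -> atlas c ->
  smooth_cov U xi -> smooth_cov U eta ->
  smooth_fun (U `&` cdom c) (fun y => omega_bar om (xi y) (eta y)).
Proof.
move=> oU ac xs es; have oUc := openI oU (cdom_open ac).
apply: (smooth_fun_chart ac oUc) => [y []//|k].
have oI : open (coord c @` (U `&` cdom c)) by rewrite setIC; exact: image_open.
pose F y : 'M[R]_n := \matrix_(k, l) gram_form (sgram om) (cfield c (delta_mx 0 k) y)
       (cfield c (delta_mx 0 l) y).
apply: (Ck_ext oI (f := fun z => \sum_i \sum_j
    pairing (xi (param c z)) (cfield c (delta_mx 0 i) (param c z)) *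
    invmx (F (param c z)) j i *
    pairing (eta (param c z)) (cfield c (delta_mx 0 j) (param c z)))).
  by move=> _ [y [Uy cy] <-]; rewrite coordK // (omega_bar_frame _ _ ac cy).
have sub V f : smooth_fun V f -> (U `&` cdom c) `<=` V ->
    Ck k (coord c @` (U `&` cdom c)) (fun z => f (param c z)).
  move=> fs UV; apply: Ck_subset (smooth_funP k ac fs).
  by move=> _ [y [Uy cy] <-]; exists y => //; split=> //; exact: UV.
apply: Ck_sum => // i; apply: Ck_sum => // j; apply: Ck_mul => //; last first.
  exact: sub (es c ac j) _.
apply: Ck_mul => //; first exact: sub (xs c ac i) _.
apply: Ck_invmx => //.
  move=> _ [y [Uy cy] <-]; rewrite coordK //.
  have -> : F y = frame c y *m sgram om y *m (frame c y)^T.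
    apply/matrixP => k' l; rewrite !mxE /gram_form !mxE.
    apply: eq_bigr => m _; rewrite !mxE; congr (_ * _).
    by apply: eq_bigr => o _; rewrite !mxE.
  by rewrite !unitmx_mul unitmx_tr frame_unit // symplectic_nondeg.
move=> k' l.
apply: (Ck_ext oI) (sub _ _ (symplectic_smooth om ac k' l) _) => [z _|y []//].
by rewrite mxE.
Qed.

(** A derivation is determined on expressions by its values on generators. A function lands in
    degree -1, where [wsm] asks for zero. *)
Lemma del_generated U k a c i : open U -> atlas c -> wgenerated false U k a ->
  wsm (k - 1) (U `&` cdom c) (fun y => del (cfield c (delta_mx 0 i) y) (a y)).
Proof.
move=> oU ac; have oUc := openI oU (cdom_open ac).
elim=> [f fs|xi xs||//|{}k {}a b ga IHa gb IHb|{}k l {}a b ga IHa gb IHb].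
- by apply: wsm_zero => // y _; rewrite del_const.
- rewrite subrr wsm_nat.
  apply: wsmooth_ext (oUc) _ (wsmooth_fun (f := fun y =>
      - (pairing (xi y) (cfield c (delta_mx 0 i) y))%:C) false oUc _).
    by move=> y _; rewrite del_gen wscaleE mulr1.
  split; first exact: smooth_funN oUc (xs c ac i).
  by apply: smooth_fun_ext (oUc) _ (smooth_fun_cst 0 oUc) => y _; rewrite /= oppr0.
- by apply: wsm_zero => // y _; rewrite del_hbar.
- apply: wsm_ext (oUc) _ (wsm_add IHa IHb) => y _.
  by rewrite delD.
- have sub : U `&` cdom c `<=` U by move=> y [].
  have sa := wsm_subset sub (wsm_generated oU ga).
  have sb := wsm_subset sub (wsm_generated oU gb).
  have S1 := wsm_mul oUc IHa sb; have S2 := wsm_mul oUc sa IHb.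
  rewrite addrAC in S1; rewrite addrA in S2.
  apply: wsm_ext (oUc) _ (wsm_add S1 S2) => y _.
  by rewrite delM.
Qed.

Lemma del_wsm U k a c i : open U -> atlas c -> wsmooth false k U a ->
  wsm (k - 1) (U `&` cdom c) (fun y => del (cfield c (delta_mx 0 i) y) (a y)).
Proof.
move=> oU ac sa; apply: wsm_local => x [Ux cx].
have [V [oV Vx [b gb ab]]] := sa _ Ux.
exists (V `&` cdom c) => //.
apply: wsm_ext (openI oV (cdom_open ac)) _ (del_generated i oV ac gb) => y [Vy _].
by rewrite ab.
Qed.

(** The commutator is a derivation in each argument, and on two covectors it is [hbar] times a
    function; dividing by [hbar] lowers the total degree by two. The inner induction on [b] is only
    entered when [a] is a covector. *)
Lemma wcomm_generated U k l a b : open U -> wgenerated false U k a ->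
  wgenerated false U l b ->
  wsm (k + l - 2) U (fun y => hbarV y * wcomm (a y) (b y)).
Proof.
move=> oU ga; elim: ga b l => [f fs|xi xs||//|{}k {}a a' ga IHa ga' IHa'|
  {}k k' {}a a' ga IHa ga' IHa'] b l gb.
- by apply: wsm_zero => // y _; rewrite wcommC wcomm_const oppr0 mulr0.
- elim: gb => [f fs|eta es||//|{}l {}b b' gb IHb gb' IHb'|
    {}l l' {}b b' gb IHb gb' IHb'].
  + by apply: wsm_zero => // y _; rewrite wcomm_const mulr0.
  + rewrite (_ : 1 + 1 - 2 = 0) // wsm_nat; apply: wsmooth_charts => c ac.
    have oUc := openI oU (cdom_open ac).
    apply: wsmooth_ext (oUc) _ (wsmooth_scale 'i oUc (wsmooth_fun (f := fun y =>
      (omega_bar om (xi y) (eta y))%:C) false oUc _)).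
      move=> y _.
      have -> : wcomm (wgen y (xi y) : wfib y) (wgen y (eta y)) =
          ('i * (omega_bar om (xi y) (eta y))%:C) *: hbar y.
        by rewrite wcommE; exact: wgen_commutator.
      rewrite [hbarV y * _]wscaleAr [hbarV y * _]hbarV_hbar.
      by rewrite [wconst y _]wconst_scale scalerA.
    split; first exact: omega_bar_smooth.
    by apply: smooth_fun_ext (oUc) _ (smooth_fun_cst 0 oUc).
  + by apply: wsm_zero => // y _; rewrite wcomm_hbar mulr0.
  + apply: wsm_ext (oU) _ (wsm_add IHb IHb') => y _.
    by rewrite wcommDr [RHS]mulrDr.
  + have S1 := wsm_mul oU IHb (wsm_generated oU gb').
    have S2 := wsm_mul oU (wsm_generated oU gb) IHb'.
    rewrite (_ : _ + _ = 1 + (l + l') - 2) in S1; last by ring.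
    rewrite (_ : _ + _ = 1 + (l + l') - 2) in S2; last by ring.
    apply: wsm_ext (oU) _ (wsm_add S1 S2) => y _.
    rewrite wcommMr [RHS]mulrDr [X in _ = X + _]mulrA; congr (_ + _).
    by rewrite !mulrA; congr (_ * _); exact/esym/hbarVC.
- by apply: wsm_zero => // y _; rewrite wcommC wcomm_hbar oppr0 mulr0.
- apply: wsm_ext (oU) _ (wsm_add (IHa b l gb) (IHa' b l gb)) => y _.
  by rewrite wcommDl [RHS]mulrDr.
- have S1 := wsm_mul oU (IHa b l gb) (wsm_generated oU ga').
  have S2 := wsm_mul oU (wsm_generated oU ga) (IHa' b l gb).
  rewrite (_ : _ + _ = k + k' + l - 2) in S1; last by ring.
  rewrite (_ : _ + _ = k + k' + l - 2) in S2; last by ring.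
  apply: wsm_ext (oU) _ (wsm_add S2 S1) => y _.
  rewrite wcommMl [RHS]mulrDr; congr (_ + _); last by rewrite [RHS]mulrA.
  by rewrite !mulrA; congr (_ * _); exact/esym/hbarVC.
Qed.

Lemma wcomm_wsm U k l a b : open U -> wsmooth false k U a -> wsmooth false l U b ->
  wsm (k + l - 2) U (fun y => hbarV y * wcomm (a y) (b y)).
Proof.
move=> oU sa sb; apply: wsm_local => x Ux.
have [V [oV Vx [a' ga aa']]] := sa _ Ux.
have [W [oW Wx [b' gb bb']]] := sb _ Ux.
have oVW := openI oV oW.
exists (V `&` W) => //.
have ga' : wgenerated false (V `&` W) k a' by apply: wgenerated_subset ga => y [].
have gb' : wgenerated false (V `&` W) l b' by apply: wgenerated_subset gb => y [].
apply: wsm_ext (oVW) _ (wcomm_generated oVW ga' gb') => y [Vy Wy].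
by rewrite aa' // bb'.
Qed.

Section InducedConnection.
Variables (D : (forall x : M, cotangent x) -> forall x : M, tangent x -> cotangent x)
  (D0 : wsec -> forall x, tangent x -> wfib x).
Arguments D0 : clear implicits.
Hypotheses (Dsymp : symplectic_connection om D) (DD0 : induced_connection D D0).

(** The conditions of [induced_connection] compute [D0] on every expression; on covector fields
    smoothness is [sconn_smooth]. *)
Lemma iconn_generated U k a c i : open U -> atlas c -> wgenerated false U k a ->
  wsm k (U `&` cdom c) (fun y => D0 a y (cfield c (delta_mx 0 i) y)).
Proof.
move=> oU ac; have oUc := openI oU (cdom_open ac).
have sub : U `&` cdom c `<=` U by move=> y [].
elim=> [f fs|xi xs||//|{}k {}a b ga IHa gb IHb|{}k l {}a b ga IHa gb IHb].
- apply: wsmooth_ext (oUc) _ (wsmooth_fun (f := fun y =>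
     tcdiff f (cfield c (delta_mx 0 i) y)) false oUc _).
    by move=> y [Uy _]; rewrite (iconn_fun DD0 oU fs).
  by split; apply: tdiff_smooth => //; case: fs.
- apply: wsmooth_ext (oUc) _ (wsmooth_cov false oUc (sconn_smooth Dsymp oU xs ac i)).
  by move=> y [Uy _]; rewrite (iconn_cov DD0 oU xs).
- by apply: wsm_zero => // y _; rewrite (iconn_hbar DD0).
- apply: wsm_ext (oUc) _ (wsm_add IHa IHb) => y [Uy _].
  by rewrite (iconn_add DD0 oU (wsmooth_generated oU (wgenerated_hinv ga))
    (wsmooth_generated oU (wgenerated_hinv gb))).
- have sa := wsm_subset sub (wsm_generated oU ga).
  have sb := wsm_subset sub (wsm_generated oU gb).
  apply: wsm_ext (oUc) _ (wsm_add (wsm_mul oUc IHa sb) (wsm_mul oUc sa IHb)) => y [Uy _].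
  by rewrite (iconn_mul DD0 oU (wsmooth_generated oU (wgenerated_hinv ga))
    (wsmooth_generated oU (wgenerated_hinv gb))).
Qed.

Lemma iconn_wsmooth U (k : nat) a c i : open U -> atlas c -> wsmooth false k%:Z U a ->
  wsmooth false k%:Z (U `&` cdom c) (fun y => D0 a y (cfield c (delta_mx 0 i) y)).
Proof.
move=> oU ac sa; apply: wsmooth_local => x [Ux cx].
have [V [oV Vx [b gb ab]]] := sa _ Ux.
exists (V `&` cdom c) => //.
apply: wsmooth_ext (openI oV (cdom_open ac)) _ (iconn_generated i oV ac gb).
by move=> y [Vy _]; rewrite (iconn_local DD0 oV ab).
Qed.

End InducedConnection.

(** * The Poincare lemma for [delta] *)

Definition evec x (i : 'I_n) : tangent x := delta_mx 0 i.
Definition ecov x (i : 'I_n) : cotangent x := delta_mx i 0.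

(** A single vector replaces the family over ['I_1] of [wform]; alternation is then void. *)
Definition oneform (k : nat) (th : forall x, tangent x -> wfib x) : Prop :=
  (forall x (r : R) (u v : tangent x), th x (r *: u + v) = r%:C *: th x u + th x v) /\
  forall c i, atlas c -> wsmooth false k%:Z (cdom c)
    (fun y => th y (cfield c (delta_mx 0 i) y)).

Lemma oneform_sum k th x m (F : 'I_m -> tangent x) : oneform k th ->
  th x (\sum_i F i) = \sum_i th x (F i).
Proof.
move=> [thP _]; have th0 : th x 0 = 0.
  have /eqP := thP x 1 0 0; rewrite scaler0 addr0 scale1r.
  by rewrite -subr_eq subrr => /eqP.
elim: m F => [|m IH] F; first by rewrite !big_ord0.
by rewrite !big_ord_recl -IH -{1}[F ord0]scale1r thP scale1r.
Qed.

Lemma oneformZ k th x (r : R) v : oneform k th -> th x (r *: v) = r%:C *: th x v.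
Proof.
move=> tho; have := tho.1 x r v 0; rewrite addr0 => ->.
have -> : (0 : tangent x) = \sum_(i < 0) 0 by rewrite big_ord0.
by rewrite (oneform_sum _ tho) big_ord0 addr0.
Qed.

Lemma oneform_evec k th x v : oneform k th ->
  th x v = \sum_i ((v : 'rV[R]_n) 0 i)%:C *: th x (evec x i).
Proof.
move=> tho; rewrite [in LHS](row_sum_delta v) (oneform_sum _ tho).
by apply: eq_bigr => i _; rewrite (oneformZ _ _ tho).
Qed.

Lemma del_evec x (v : tangent x) a :
  del v a = \sum_i ((v : 'rV[R]_n) 0 i)%:C *: del (evec x i) a.
Proof.
have del0l : del (0 : tangent x) a = 0.
  have /eqP := delP 1 (0 : tangent x) 0 a; rewrite scaler0 addr0 scale1r.
  by rewrite -subr_eq subrr => /eqP.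
have dels m (F : 'I_m -> tangent x) : del (\sum_i F i) a = \sum_i del (F i) a.
  elim: m F => [|m IH] F; first by rewrite !big_ord0.
  by rewrite !big_ord_recl -IH -{1}[F ord0]scale1r delP scale1r.
rewrite [in LHS](row_sum_delta v) dels; apply: eq_bigr => i _.
by have := delP ((v : 'rV[R]_n) 0 i) (evec x i) 0 a; rewrite addr0 del0l addr0.
Qed.

Lemma del_linear x (v : tangent x) : linear (del v).
Proof. by move=> z a b; rewrite delD delZ. Qed.
HB.instance Definition _ x (v : tangent x) :=
  GRing.isLinear.Build R[i] (wfib x) (wfib x) *:%R (del v) (del_linear v).

(** These left multiplications do not commute with one another, but the number operator argument
    only relies on their commutation with [del]. This is what makes a basis of ordered monomials
    dispensable. *)
Definition lmulgen x (xi : cotangent x) (a : wfib x) : wfib x := wgen x xi * a.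
Lemma lmulgen_linear x (xi : cotangent x) : linear (lmulgen xi).
Proof. by move=> z a b; rewrite /lmulgen mulrDr [_ * (z *: a)]wscaleAr. Qed.
HB.instance Definition _ x (xi : cotangent x) :=
  GRing.isLinear.Build R[i] (wfib x) (wfib x) *:%R (lmulgen xi) (lmulgen_linear xi).

Definition delL x i : {linear wfib x -> wfib x} := del (evec x i).
Definition genL x i : {linear wfib x -> wfib x} := lmulgen (ecov x i).

Lemma delLC x i j (a : wfib x) : delL x i (delL x j a) = delL x j (delL x i a).
Proof. exact: delC. Qed.

Lemma delL_genL x i j (a : wfib x) :
  delL x i (genL x j a) = genL x j (delL x i a) - (i == j)%:R *: a.
Proof.
rewrite /= /lmulgen delM del_gen [X in X + _]wscaleAl mul1r scaleNr addrC.
congr (_ - _ *: _).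
rewrite /pairing /evec /ecov mul_delta_mx_cond.
by case: (i == j); rewrite ?mulr1n ?mulr0n !mxE ?eqxx.
Qed.

(** A contraction over dual bases is independent of the bases. It trades the basis of [chart_at y]
    for the frame of a fixed chart, where smoothness can be checked. *)
Lemma genL_sum_chart c y (th : tangent y -> wfib y) :
  (forall v, th v = \sum_i ((v : 'rV[R]_n) 0 i)%:C *: th (evec y i)) ->
  atlas c -> cdom c y ->
  \sum_i genL y i (th (evec y i)) =
  \sum_i wgen y (ccov c i y) * th (cfield c (delta_mx 0 i) y).
Proof.
move=> thE ac cy.
have gs m (F : 'I_m -> cotangent y) :
    wgen y (\sum_i F i) = \sum_i (wgen y (F i) : wfib y).
  elim: m F => [|m IH] F; first by rewrite !big_ord0; exact: wgen0.
  by rewrite !big_ord_recl -IH; exact: wgenD.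
transitivity (\sum_i \sum_j
    wgen y (frame c y i j *: ccov c i y) * th (evec y j) : wfib y).
  rewrite exchange_big; apply: eq_bigr => j _ /=; rewrite /lmulgen -mulr_suml -gs.
  congr (wgen y _ * _); apply/colP => k; rewrite summxE.
  have /matrixP /(_ k j) := coframe_frame ac cy.
  rewrite !mxE eqxx andbT => <-; apply: eq_bigr => i _.
  by rewrite !mxE mulrC.
apply: eq_bigr => i _; rewrite [in RHS]thE mulr_sumr; apply: eq_bigr => j _.
have -> (r : R) (xi : cotangent y) : wgen y (r *: xi) = r%:C *: wgen y xi :> wfib y.
  exact: wgenZ.
by rewrite [LHS]wscaleAl [RHS]wscaleAr mxE.
Qed.

Lemma codiff_wsmooth k th : oneform k th ->
  wsmooth false k.+1%:Z setT (fun x => codiff (genL x) (fun i => th x (evec x i))).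
Proof.
move=> tho; apply: wsmooth_charts => c ac; rewrite setTI.
have oc := cdom_open ac.
rewrite /codiff.
apply: wsmooth_ext (oc) _ (wsmooth_opp oc (wsmooth_sum (k := k.+1) (a := fun i y =>
   (wgen y (ccov c i y) : wfib y) * th y (cfield c (delta_mx 0 i) y)) oc _)).
  by move=> y cy; rewrite (genL_sum_chart (fun v => oneform_evec v tho) ac cy).
move=> i; rewrite -(addn1 k) PoszD addrC.
apply: wsmooth_mul; last exact: tho.2.
exact: wsmooth_cov (ccov_smooth _ ac).
Qed.

Lemma oneform_del k a : wsmooth false k.+1%:Z setT a ->
  oneform k (fun x v => del v (a x)).
Proof.
move=> sa; split=> [x r u v|c i ac]; first exact: delP.
have := del_wsm i openT ac sa; rewrite setTI.
by rewrite (_ : k.+1%:Z - 1 = k%:Z) // intS addrAC subrr add0r.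
Qed.

Lemma oneform_sub k th th' : oneform k th -> oneform k th' ->
  oneform k (fun x v => th x v - th' x v).
Proof.
move=> [tP ts] [tP' ts']; split=> [x r u v|c i ac].
  by rewrite tP tP' scalerBr opprD addrACA.
by apply: wsmooth_sub; [exact: cdom_open|exact: ts|exact: ts'].
Qed.

Lemma oneform_add k th th' : oneform k th -> oneform k th' ->
  oneform k (fun x v => th x v + th' x v).
Proof.
move=> [tP ts] [tP' ts']; split=> [x r u v|c i ac].
  by rewrite tP tP' scalerDr addrACA.
by apply: wsmooth_add; [exact: ts|exact: ts'].
Qed.

(** Each [del] lowers the degree by one, and in degree -1 [wsm] means vanishing. *)
Lemma wsmooth_dnil k (a : wsec) U x : open U -> U x -> wsmooth false k%:Z U a ->
  dnil (delL x) k (a x).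
Proof.
move=> oU Ux; elim: k a U oU Ux => [|k IH] a U oU Ux sa i /=.
  have := del_wsm i oU (chart_at_atlas x) sa.
  have xc := chart_at_dom x.
  by move=> /(_ x (conj Ux xc)); rewrite cfield_chart_at.
have := del_wsm i oU (chart_at_atlas x) sa.
rewrite (_ : k.+1%:Z - 1 = k%:Z); last by rewrite intS addrAC subrr add0r.
have xU : (U `&` cdom (chart_at x)) x by split=> //; exact: chart_at_dom.
move=> /(IH _ _ (openI oU (cdom_open (chart_at_atlas x))) xU).
by rewrite cfield_chart_at.
Qed.

Definition del_closed (th : forall x, tangent x -> wfib x) : Prop :=
  forall x (u v : tangent x), del u (th x v) = del v (th x u).

Lemma poincare_aux k m th : oneform k th -> del_closed th ->
  (forall x i, Nprod (delL x) (genL x) m 0 (th x (evec x i)) = 0) ->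
  exists2 a : wsec, wsmooth false k.+1%:Z setT a & forall x v, del v (a x) = th x v.
Proof.
elim: m th => [|m IH] th tho thc th0.
  exists (fun=> 0); first exact: wsmooth0 openT.
  move=> x v; rewrite del0 (oneform_evec v tho) big1 // => i _.
  by have /= -> := th0 x i; rewrite scaler0.
(* The constant is forced: [th - z (1 + N) th = - z (N - m) th], so the innermost factor of
   [Nprod m.+1 0] is absorbed into the new form. *)
set z : R[i] := (m.+1%:R)^-1.
pose a1 : wsec := fun x => z *: codiff (genL x) (fun i => th x (evec x i)).
have sa1 : wsmooth false k.+1%:Z setT a1.
  by apply: wsmooth_scale openT _; exact: codiff_wsmooth.
have da1 x j : del (evec x j) (a1 x) =
    z *: (th x (evec x j) + Nop (delL x) (genL x) (th x (evec x j))).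
  rewrite delZ; congr (_ *: _).
  apply: (d_codiff (d := delL x)); first exact: delL_genL.
  by move=> i; exact: thc.
pose th' := fun x (v : tangent x) => th x v - del v (a1 x).
have tho' : oneform k th' by apply: oneform_sub => //; exact: oneform_del.
have [|x j|a sa da] := IH th' tho'.
- by move=> x u v; rewrite /th' !delD !delN thc delC.
- rewrite /th' da1.
  have -> : th x (evec x j) -
      z *: (th x (evec x j) + Nop (delL x) (genL x) (th x (evec x j))) =
      - z *: (Nop (delL x) (genL x) (th x (evec x j)) - (0 + m)%:R *: th x (evec x j)).
    move: (th x _) (Nop _ _ _) => t N.
    rewrite add0n scaleNr scalerBr scalerDr opprB opprD addrA scalerA; congr (_ - _).
    rewrite -{1}[t]scale1r -scalerBl; congr (_ *: _).
    have m0 : (m.+1%:R : R[i]) != 0 by rewrite pnatr_eq0.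
    apply: (mulfI m0); rewrite mulrBr mulrA /z mulfV // mulr1 mul1r.
    by rewrite -[m.+1]addn1 natrD addrK.
  by rewrite NprodZ -Nprod_recr th0 scaler0.
exists (fun x => a x + a1 x); first exact: wsmooth_add.
by move=> x v; rewrite delD da /th' subrK.
Qed.

Lemma poincare k th : oneform k th -> del_closed th ->
  exists2 a : wsec, wsmooth false k.+1%:Z setT a & forall x v, del v (a x) = th x v.
Proof.
move=> tho thc; apply: (poincare_aux (m := k.+1) tho thc) => x i.
apply: Nprod_dnil; [exact: delLC|exact: delL_genL|].
have := tho.2 (chart_at x) i (chart_at_atlas x).
move=> /(wsmooth_dnil (cdom_open (chart_at_atlas x)) (chart_at_dom x)).
by rewrite cfield_chart_at.
Qed.

(** * Fedosov connections *)

Lemma ext_deriv0E (B : M -> zmodType)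
    (D : (forall x, B x) -> forall x, tangent x -> B x) (a : forall x, B x)
    x (w : 'I_1 -> tangent x) :
  ext_deriv D (fun x (_ : 'I_0 -> tangent x) => a x) x w = D a x (w ord0).
Proof. by rewrite /ext_deriv big_ord1. Qed.

Lemma ext_deriv1E (B : M -> zmodType)
    (D : (forall x, B x) -> forall x, tangent x -> B x) (th : dform B 1)
    x (v : 'I_2 -> tangent x) :
  ext_deriv D th x v =
  D (fun y => th y (fun=> cfield (chart_at x) (v ord_max) y)) x (v ord0) -
  D (fun y => th y (fun=> cfield (chart_at x) (v ord0) y)) x (v ord_max).
Proof.
rewrite /ext_deriv big_ord_recr big_ord1 /=.
have -> : widen_ord (leqnSn 1) ord0 = ord0 :> 'I_2 by apply/val_inj.
have thE (k k' : 'I_2) : (forall i : 'I_1, lift k i = k') ->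
    (fun y => th y (fun i => cfield (chart_at x) (v (lift k i)) y)) =
    (fun y => th y (fun=> cfield (chart_at x) (v k') y)).
  move=> kk'; apply: functional_extensionality_dep => y.
  have vE : (fun i : 'I_1 => cfield (chart_at x) (v (lift k i)) y) =
    (fun=> cfield (chart_at x) (v k') y) by apply/funext => i; rewrite kk'.
  exact: (f_equal (th y) vE).
have l0 (i : 'I_1) : lift ord0 i = ord_max :> 'I_2 by rewrite ord1; exact/val_inj.
have l1 (i : 'I_1) : lift ord_max i = ord0 :> 'I_2 by rewrite ord1; exact/val_inj.
exact: (congr2 (fun f g => D f x (v ord0) - D g x (v ord_max))
  (thE _ _ l0) (thE _ _ l1)).
Qed.

Lemma ext_deriv2_0E (B : M -> zmodType)
    (D : (forall x, B x) -> forall x, tangent x -> B x) (a : forall x, B x)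
    x (v : 'I_2 -> tangent x) :
  ext_deriv D (ext_deriv D (fun x (_ : 'I_0 -> tangent x) => a x)) x v =
  D (fun y => D a y (cfield (chart_at x) (v ord_max) y)) x (v ord0) -
  D (fun y => D a y (cfield (chart_at x) (v ord0) y)) x (v ord_max).
Proof.
rewrite ext_deriv1E.
have DE w : (fun y => ext_deriv D (fun x (_ : 'I_0 -> tangent x) => a x) y
    (fun=> cfield (chart_at x) w y)) = (fun y => D a y (cfield (chart_at x) w y)).
  by apply: functional_extensionality_dep => y; exact: ext_deriv0E.
exact: (congr2 (fun f g => D f x (v ord0) - D g x (v ord_max)) (DE _) (DE _)).
Qed.

Section Fedosov.
Variable F : fedosov_connection om.
Local Notation D0 := (fconn0 F).
Local Notation cov := (covariant (fconn0 F) (fconnA F)).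
Local Notation Asec i x v := (@fconnA R n M om F i x (fun=> v : tangent x) : wfib x).
Local Notation conn := (fconn0_induced F).

Lemma oneform_ext k th th' : (forall x v, th x v = th' x v) ->
  oneform k th -> oneform k th'.
Proof.
move=> tt [tP ts]; split=> [x r u v|c i ac]; first by rewrite -!tt.
by apply: wsmooth_ext (ts c i ac) => //; exact: cdom_open.
Qed.

Lemma oneform0 k : oneform k (fun x v => 0).
Proof.
split=> [x r u v|c i ac]; first by rewrite scaler0 addr0.
by apply: wsmooth0; exact: cdom_open.
Qed.

Lemma oneform_iconn k a : wsmooth false k%:Z setT a -> oneform k (fun x v => D0 a v).
Proof.
move=> sa; split=> [x r u v|c i ac].
  exact: (iconn_linear conn openT (wsmooth_hinv sa)).
have := iconn_wsmooth (fconn_symplectic F) conn i openT ac sa.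
by rewrite setTI.
Qed.

Lemma etaI1 (T : Type) (v : 'I_1 -> T) (u : T) :
  ([eta v with 0 |-> u] : 'I_1 -> T) = (fun=> u).
Proof. by apply/funext => i; rewrite /= ord1. Qed.

(** [A_i] itself may contain [hbarV]; clearing this denominator gives a form of degree [i + 2] with
    values in the Weyl bundle proper. *)
Definition ihA i x (v : tangent x) : wfib x := 'i *: hbar x * Asec i x v.

Lemma oneform_ihA i : oneform i.+2 (ihA i).
Proof.
have [AP _ As] := fconnA_form F i; split=> [x r u v|c j ac].
  by have := AP x (fun=> 0) 0 r u v; rewrite !etaI1.
exact: As c ac (fun=> j).
Qed.

Lemma wcomm_AsecE i x (v : tangent x) (a : wfib x) :
  wcomm (Asec i x v) a = 'i^-1 *: (hbarV x * wcomm (ihA i v) a).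
Proof.
rewrite -wcomm_hbarVl -wcommZl; congr (wcomm _ a).
have -> : ihA i v = 'i *: (hbar x * Asec i x v) :> wfib x by exact: wscaleAl.
have -> (b : wfib x) : hbarV x * ('i *: (hbar x * b)) = 'i *: b :> wfib x.
  by rewrite [LHS]wscaleAr [_ * (_ * b)]mulrA [hbarV x * hbar x]hbarV_hbar mul1r.
rewrite scalerA mulVf ?scale1r //.
by rewrite eq_complex /= oner_eq0 andbF.
Qed.

(** The denominator of [A_i] is absorbed by the factor [hbar] of a commutator, in degree
    [(i + 2) + k - 2]. *)
Lemma oneform_comm_A i k a : wsmooth false k%:Z setT a ->
  oneform (i + k) (fun x v => wcomm (Asec i x v) (a x)).
Proof.
move=> sa; apply: (oneform_ext (fun x v => esym (wcomm_AsecE i v (a x)))).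
have [BP Bs] := oneform_ihA i; split=> [x r u v|c j ac].
  rewrite BP wcommDl wcommZl [hbarV x * (_ + _)]mulrDr [hbarV x * (_ *: _)]wscaleAr.
  by rewrite scalerDr !scalerA mulrC.
have oc := cdom_open ac.
have := wcomm_wsm oc (Bs c j ac) (wsmooth_subset (@subsetT _ _) sa).
rewrite (_ : _ - 2 = (i + k)%N%:Z).
  by rewrite wsm_nat => H; apply: wsmooth_scale.
by rewrite -[i.+2]addn2 !PoszD; ring.
Qed.

Lemma wsmooth_hbarX h U m : open U -> wsmooth h (2 * m)%N%:Z U (fun x => hbar x ^+ m).
Proof.
move=> oU; elim: m => [|m IH]; first exact: wsmooth_cst.
have := wsmooth_mul (wsmooth_hbar h oU) IH.
rewrite (_ : 2 + _ = (2 * m.+1)%N%:Z); last by rewrite mulnS PoszD.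
by apply: wsmooth_ext => // x _; rewrite exprS.
Qed.

Lemma wsmooth_chbarX h U m f : open U -> smooth_cfun U f ->
  wsmooth h (2 * m)%N%:Z U (fun x => f x *: hbar x ^+ m : wfib x).
Proof.
move=> oU fs; have := wsmooth_mul (wsmooth_fun h oU fs) (wsmooth_hbarX h m oU).
by rewrite add0r; apply: wsmooth_ext.
Qed.

Lemma oneform_central (alpha : nat -> dform (fun=> R[i]^o) 1) k :
  (forall m, scalar_form (alpha m)) ->
  oneform k (fun x v => central om x (fun m => alpha m x (fun=> v)) k).
Proof.
move=> as_; rewrite /central; case ek: (odd k); first exact: oneform0.
have [aP _ ass] := as_ k./2; split=> [x r u v|c i ac].
  have := aP x (fun=> 0) 0 r u v; rewrite !etaI1 => ->.
  by rewrite scalerDl scalerA.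
have kE : k = (2 * k./2)%N by rewrite mul2n -[LHS]odd_double_half ek.
rewrite {1}kE; apply: wsmooth_chbarX; first exact: cdom_open.
exact: ass c ac (fun=> i).
Qed.

Lemma wcomm_central x (a : wfib x) f k : wcomm a (central om x f k) = 0.
Proof.
rewrite /central; case: ifP => _; first exact: wcomm0.
by rewrite wcommZr wcomm_hbarX scaler0.
Qed.

Definition smooth_series (a : forall x, wplus om x) : Prop :=
  forall k : nat, wsmooth false k%:Z setT (fun x => a x k).

(** Lets a series be replaced by a truncation, both in the recursion for the primitive and in the
    exponential series. *)
Lemma cov_agree (a b : forall x, wplus om x) x v k :
  (forall y j, (j <= k.+1)%N -> a y j = b y j) -> cov a x v k = cov b x v k.
Proof.
move=> ab; rewrite /covariant ab //.
have -> : (fun y => a y k) = (fun y => b y k).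
  by apply: functional_extensionality_dep => y; rewrite ab // leqnSn.
congr (_ + _); apply: eq_bigr => i _; rewrite ab //.
by apply: leq_trans (leq_subr _ _) (leqnSn _).
Qed.

Lemma oneform_sum_idx k m (th : 'I_m -> forall x, tangent x -> wfib x) :
  (forall i, oneform k (th i)) -> oneform k (fun x v => \sum_(i < m) th i x v).
Proof.
elim: m th => [|m IH] th tho.
  by apply: oneform_ext (oneform0 k) => x v; rewrite big_ord0.
apply: oneform_ext (oneform_add (tho ord0) (IH (fun i => th (lift ord0 i)) _)) => //.
by move=> x v; rewrite big_ord_recl.
Qed.

Lemma oneform_cov a k : smooth_series a -> (oneform k (fun x v => cov a x v k)).
Proof.
move=> sa; rewrite /covariant; apply: oneform_add; first apply: oneform_add.
- exact: oneform_del (sa k.+1).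
- exact: oneform_iconn (sa k).
- apply: oneform_sum_idx => i.
  have := oneform_comm_A i (sa (k - i)%N); rewrite subnKC //.
  by rewrite -ltnS.
Qed.

Lemma iconn_0 x (v : tangent x) : D0 (fun y => 0) v = 0.
Proof.
have s0 := wsmooth0 true 0 (@openT M).
have := iconn_add conn openT s0 s0 v I.
rewrite (_ : (fun y => 0 + 0) = (fun y => 0 : wfib y)).
  by move=> /eqP; rewrite -subr_eq subrr => /eqP.
by apply: functional_extensionality_dep => y; rewrite addr0.
Qed.

Lemma iconn_hbarX m x (v : tangent x) : D0 (fun y => hbar y ^+ m) v = 0.
Proof.
elim: m => [|m IH].
  have := iconn_fun conn openT (smooth_cfun_cst 1 openT) v I.
  rewrite /tcdiff !tdiff_cst => ->.
  by [].
have -> : (fun y => hbar y ^+ m.+1) = (fun y => hbar y * hbar y ^+ m).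
  by apply: functional_extensionality_dep => y; rewrite exprS.
rewrite (iconn_mul conn openT (wsmooth_hbar true openT) (wsmooth_hbarX true m openT)) //.
by rewrite IH mulr0 addr0 (iconn_hbar conn) mul0r.
Qed.

(** Powers of [hbar] are parallel, so only the coefficients are differentiated; this is where the
    exterior derivative of [alpha] arises. *)
Lemma iconn_central U x (v : tangent x) (f : nat -> M -> R[i]) k : open U ->
  (forall m, smooth_cfun U (f m)) -> U x ->
  D0 (fun y => central om y (fun m => f m y) k) v =
  central om x (fun m => tcdiff (f m) v) k.
Proof.
move=> oU fs Ux; rewrite /central; case: (odd k); first exact: iconn_0.
have := iconn_mul conn oU (wsmooth_fun true oU (fs k./2))
  (wsmooth_hbarX true k./2 oU) v Ux.
rewrite iconn_hbarX mulr0 addr0 (iconn_fun conn oU (fs _)) //.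
Qed.

(** Below degree [k] the form [nabla a] is central, so its brackets with the [A_i] vanish and the
    induced connection acts on it as [d]. In degree [k - 1] the equation [nabla (nabla a) = 0] thus
    reduces to [d alpha] minus [delta] of the residual. *)
Lemma residual_closed (alpha : nat -> dform (fun=> R[i]^o) 1) a k :
  (forall m, scalar_form (alpha m)) ->
  (forall m x v, ext_d (alpha m) x v = 0) ->
  smooth_series a -> (forall x, a x 0%N = 0) ->
  (forall j x v, (j < k)%N ->
     cov a x v j = central om x (fun m => alpha m x (fun=> v)) j) ->
  del_closed (fun x v => central om x (fun m => alpha m x (fun=> v)) k - cov a x v k).
Proof.
move=> as_ ad sa a0 aE.
set th := fun x v => _.
have tho : oneform k th.
  by apply: oneform_sub; [exact: oneform_central|exact: oneform_cov].
(* The coefficients of [alpha] are given as smooth functions along coordinate frame fields, so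
   bilinearity is used to pass to basis vectors. *)
suff H x i j : del (evec x i) (th x (evec x j)) = del (evec x j) (th x (evec x i)).
  move=> x u v; rewrite (oneform_evec v tho) (oneform_evec u tho).
  rewrite ![del _ (\sum_i _)]linear_sum.
  under eq_bigr do rewrite linearZ /= del_evec scaler_sumr.
  under [RHS]eq_bigr do rewrite linearZ /= del_evec scaler_sumr.
  rewrite exchange_big /=; apply: eq_bigr => p _; apply: eq_bigr => q _.
  by rewrite H !scalerA mulrC.
have ct := chart_at_atlas x; have cx := chart_at_dom x.
case: k aE @th tho => [|k] aE th tho.
  (* In degree 0 there is no component of the curvature to use, but [del] kills everything of degree
     0. *)
  have H l l' : del (evec x l) (th x (evec x l')) = 0.
    have := tho.2 _ l' ct.
    move=> /(wsmooth_dnil (cdom_open ct) cx) /(_ l).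
    by rewrite cfield_chart_at.
  by rewrite !H.
have aW : Wform (fun x (_ : 'I_0 -> tangent x) => a x).
  move=> l; split=> [y w []//|y w []//|c ac e].
  exact: wsmooth_subset (sa l).
pose al l m y := alpha m y (fun=> cfield (chart_at x) (evec x l) y).
have covE l l' : cov (fun y => cov a y (cfield (chart_at x) (evec x l') y)) x (evec x l) k =
   central om x (fun m => tcdiff (al l' m) (evec x l)) k
   - del (evec x l) (th x (evec x l')).
  set s := fun y => cov a y _.
  have sE m y : (m <= k)%N -> s y m = central om y (fun m => al l' m y) m.
    by move=> mk; rewrite /s aE.
  rewrite [LHS]/covariant.
  have -> : (fun y => s y k) = (fun y => central om y (fun m => al l' m y) k).
    by apply: functional_extensionality_dep => y; exact: sE.
  rewrite (iconn_central (U := cdom (chart_at x)) _ _ (cdom_open ct)) //; last first.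
    by move=> m; have [_ _ ams] := as_ m; exact: (ams _ ct (fun=> l')).
  rewrite big1 ?addr0; last first.
    by move=> q _; rewrite sE ?leq_subr // wcomm_central.
  rewrite addrC; congr (_ + _).
  rewrite /th delD delN [del _ (central _ _ _ _)]wcomm_central add0r opprK /s.
  by rewrite cfield_chart_at.
have dE : (fun m => tcdiff (al j m) (evec x i)) =
          (fun m => tcdiff (al i m) (evec x j)).
  apply/funext => m.
  have := ad m x (fun l : 'I_2 => if l == ord0 then evec x i else evec x j).
  by rewrite /ext_d ext_deriv1E => /subr0_eq.
(* As [[A_{-1}, -]] lowers the degree by one, the residual of degree [k.+1] shows up in the
   curvature in degree [k]. *)
have := fconn_flat F aW (fun l : 'I_2 => if l == ord0 then evec x i else evec x j).
rewrite ext_deriv2_0E => /(congr1 (fun s : wplus om x => s k)).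
have cancel (A B C C' P Q : wfib x) : A = C - P -> B = C' - Q -> C = C' ->
    A - B = 0 -> P = Q.
  by move=> -> -> -> /subr0_eq /addrI /oppr_inj.
exact: cancel (covE i j) (covE j i) (f_equal (fun f => central om x f k) dE).
Qed.

(** * Primitives of closed central one-forms *)

Section Primitive.
Variable alpha : nat -> dform (fun _ : M => R[i]^o) 1.
Arguments alpha : clear implicits.
Hypothesis alpha_form : forall m, scalar_form (alpha m).
Hypothesis alpha_closed : forall m x v, ext_d (alpha m) x v = 0.
Definition cser x (v : tangent x) : wplus om x :=
  central om x (fun m => alpha m x (fun=> v)).

(** With nothing above degree [k], the degree [k] part of [nabla a] has no [[A_{-1}, -]] term; a new
    component of degree [k + 1] then simply adds its [delta]. *)
Definition primitive_upto k (a : forall x, wplus om x) : Prop :=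
  [/\ smooth_series a, forall x, a x 0%N = 0,
      forall x j, (k < j)%N -> a x j = 0 &
      forall j x v, (j < k)%N -> cov a x v j = cser v j].

Lemma primitive_step k a : primitive_upto k a ->
  exists2 a', primitive_upto k.+1 a' & forall x j, (j <= k)%N -> a' x j = a x j.
Proof.
move=> [sa a0 ak aE].
have tho : oneform k (fun x v => cser v k - cov a x v k).
  by apply: oneform_sub; [exact: oneform_central|exact: oneform_cov].
have [b sb db] := poincare tho (residual_closed alpha_form alpha_closed sa a0 aE).
pose a' x : wplus om x := fun j => if j == k.+1 then b x else a x j.
have a'E x j : (j <= k)%N -> a' x j = a x j.
  by move=> jk; rewrite /a' ltn_eqF.
exists a' => //; split.
- move=> j; rewrite /a'; case: eqP => [->//|_]; exact: sa.
- by move=> x; rewrite a'E // a0.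
- move=> x j kj; rewrite /a' gtn_eqF // ak //; exact: ltnW.
- move=> j x v; rewrite ltnS leq_eqVlt => /orP[/eqP->|jk]; last first.
    (* An equation in degree [j < k] only involves components up to [j + 1], which are unchanged. *)
    rewrite -aE //; apply: cov_agree => y l lj; apply: a'E; exact: leq_trans jk.
  have D0E : D0 (fun y => a' y k) v = D0 (fun y => a y k) v.
    apply: (f_equal (fun s => D0 s v)).
    by apply: functional_extensionality_dep => y; exact: a'E.
  have SE : \sum_(i < k.+1) wcomm (Asec i x v) (a' x (k - i)%N) =
            \sum_(i < k.+1) wcomm (Asec i x v) (a x (k - i)%N).
    by apply: eq_bigr => i _; rewrite a'E // leq_subr.
  have dE : wcomm (Aminus1 om v) (a' x k.+1) = cser v k - cov a x v k.
    by rewrite -db /a' eqxx.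
  have cE : cov a x v k = D0 (fun y => a y k) v +
      \sum_(i < k.+1) wcomm (Asec i x v) (a x (k - i)%N).
    by rewrite {1}/covariant ak // wcomm0 add0r.
  by rewrite {1}/covariant D0E SE dE -addrA -cE subrK.
Qed.

Lemma primitive : exists a, [/\ smooth_series a, forall x, a x 0%N = 0 &
  forall x v, cov a x v = cser v].
Proof.
have p0 : primitive_upto 0 (fun x => 0 : wplus om x).
  split=> // k; exact: wsmooth0 openT.
(* Each stage carries its proof, which makes the choice of the next stage a function that can be
   iterated. *)
pose T k := {a | primitive_upto k a}.
pose next k (t : T k) : T k.+1 :=
  let e := cid2 (primitive_step (svalP t)) in exist _ (s2val e) (s2valP e).
have nextE k (t : T k) x j : (j <= k)%N -> sval (next k t) x j = sval t x j.
  exact: (s2valP' (cid2 (primitive_step (svalP t)))).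
pose t := fix t k : T k := if k is k'.+1 then next k' (t k') else exist _ _ p0.
(* Later stages leave the components up to [k] of stage [k] alone, so the diagonal is the limit of
   the stages. *)
pose a x : wplus om x := fun k => sval (t k) x k.
have aE k x j : (j <= k)%N -> a x j = sval (t k) x j.
  elim: k => [|k IH]; first by rewrite leqn0 => /eqP->.
  rewrite leq_eqVlt => /orP[/eqP->//|jk]; rewrite IH //.
  by rewrite -[sval (t k.+1)]/(sval (next k (t k))) nextE.
exists a; split.
- by move=> k; have [sa _ _ _] := svalP (t k); exact: sa.
- by move=> x; have [_ a0 _ _] := svalP (t 0%N); exact: a0.
- move=> x v; apply/funext => k.
  have [_ _ _ <-//] := svalP (t k.+1).
  by apply: cov_agree => y j; exact: aE.
Qed.

End Primitive.

(** * The Leibniz rule and the exponential *)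

Lemma smooth_series_smul a b : smooth_series a -> smooth_series b ->
  smooth_series (fun x => smul (a x) (b x)).
Proof.
move=> sa sb k; apply: (wsmooth_sum (a := fun i x => a x i * b x (k - i)%N) openT) => i.
have := wsmooth_mul (sa i) (sb (k - i)%N).
by rewrite -PoszD subnKC // -ltnS.
Qed.

Lemma smooth_series_sone : smooth_series (fun x => sone (wfib x)).
Proof.
move=> k; rewrite /sone; case: eqP => [->|_].
  exact: wsmooth_cst openT.
exact: wsmooth0 openT.
Qed.

Lemma smooth_series_spow a j : smooth_series a -> smooth_series (fun x => spow (a x) j).
Proof.
move=> sa; elim: j => [|j IH]; first exact: smooth_series_sone.
exact: smooth_series_smul.
Qed.

Lemma smooth_series_sexp a : smooth_series a -> smooth_series (fun x => sexp (a x)).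
Proof.
move=> sa k.
apply: (wsmooth_sum (a := fun j x => ((j`!)%:R)^-1 *: spow (a x) j k) openT) => j.
exact: wsmooth_scale openT (smooth_series_spow _ sa _).
Qed.

Lemma smooth_series_sub a b : smooth_series a -> smooth_series b ->
  smooth_series (fun x => a x - b x).
Proof. by move=> sa sb k; exact: wsmooth_sub openT (sa k) (sb k). Qed.

Lemma smooth_series_sinv a : smooth_series a -> (forall x, a x 0%N = 1) ->
  smooth_series (fun x => sinv (a x)).
Proof.
move=> sa a0 k.
have su := smooth_series_sub smooth_series_sone sa.
apply: wsmooth_ext (openT) _ (wsmooth_sum (k := k) (m := k.+1)
   (a := fun j x => spow (sone (wfib x) - a x) j k) openT _).
  by move=> x _; rewrite (sinvE (a0 x)).
by move=> j; exact: smooth_series_spow su k.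
Qed.

Lemma del_degree0 (s : wsec) x (v : tangent x) :
  wsmooth false 0 setT s -> del v (s x) = 0.
Proof.
move=> ss; rewrite del_evec big1 // => i _.
by rewrite [del _ _](wsmooth_dnil (k := 0) openT I ss i) scaler0.
Qed.

Lemma covE a x v k : cov a x v k = del v (a x k.+1) + D0 (fun y => a y k) v +
  \sum_(i < k.+1) wcomm (Asec i x v) (a x (k - i)%N).
Proof. by []. Qed.

Lemma covD a b x v k : smooth_series a -> smooth_series b ->
  cov (fun y => a y + b y) x v k = cov a x v k + cov b x v k.
Proof.
move=> sa sb; rewrite !covE.
have D0E : D0 (fun y => a y k + b y k) v = D0 (fun y => a y k) v + D0 (fun y => b y k) v.
  exact: (iconn_add conn openT (wsmooth_hinv (sa k)) (wsmooth_hinv (sb k))).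
rewrite [X in _ + X + _]D0E [del v _]delD.
under eq_bigr do rewrite [wcomm _ _]wcommDr.
by rewrite big_split /= [X in X + _ = _]addrACA [LHS]addrACA.
Qed.

Lemma iconnZ z (k : nat) (s : wsec) x (v : tangent x) : wsmooth false k%:Z setT s ->
  D0 (fun y => z *: s y) v = z *: D0 s v.
Proof.
move=> ss.
have := iconn_mul conn openT (wsmooth_cst true z openT) (wsmooth_hinv ss) v I.
rewrite (iconn_fun conn openT (smooth_cfun_cst z openT)) //.
rewrite /tcdiff !tdiff_cst [X in X + _]mul0r add0r.
exact.
Qed.

Lemma covZ z a x v k : smooth_series a ->
  cov (fun y => z *: a y) x v k = z *: cov a x v k.
Proof.
move=> sa; rewrite !covE [RHS]scalerDr [X in _ = X + _]scalerDr.
rewrite [X in _ + X + _](iconnZ z v (sa k)) [del v _]delZ scaler_sumr.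
by congr (_ + _); apply: eq_bigr => i _; rewrite [LHS]wcommZr.
Qed.

Lemma cov_sum m (c : 'I_m -> R[i]) (a : 'I_m -> forall x, wplus om x) x v k :
  (forall j, smooth_series (a j)) ->
  cov (fun y => \sum_j c j *: a j y) x v k = \sum_j c j *: cov (a j) x v k.
Proof.
elim: m c a => [|m IH] c a sa.
  rewrite big_ord0.
  have s1 := smooth_series_sone.
  have := covZ 0 v k s1; rewrite scale0r => <-.
  apply: cov_agree => y j _; rewrite big_ord0 //.
  by rewrite -[RHS]/(0 *: sone (wfib y) j) scale0r.
rewrite big_ord_recl -IH // -covZ // -covD.
- by apply: cov_agree => y j _; rewrite big_ord_recl.
- by move=> j; exact: wsmooth_scale openT (sa _ j).
- move=> j; apply: wsmooth_ext (openT) _ (wsmooth_sum (k := j)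
    (a := fun l y => c (lift ord0 l) *: a (lift ord0 l) y j) openT _).
    by move=> y _; rewrite fct_sumE.
  by move=> l; exact: wsmooth_scale openT (sa _ j).
Qed.

Lemma sum_wcomm x (A s : nat -> wfib x) k :
  \sum_(i < k.+1) wcomm (A i) (s (k - i)%N) = smul A s k - smul s A k.
Proof.
rewrite sumrB; congr (_ - _).
rewrite (reindex_inj rev_ord_inj); apply: eq_bigr => i _ /=.
by rewrite subSS subKn // -ltnS.
Qed.

Lemma iconn_sum m k (s : 'I_m -> wsec) x (v : tangent x) :
  (forall i, wsmooth false k%:Z setT (s i)) ->
  D0 (fun y => \sum_i s i y) v = \sum_i D0 (s i) v.
Proof.
elim: m s => [|m IH] s ss.
  rewrite big_ord0 -(iconn_0 v); apply: (f_equal (fun t => D0 t v)).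
  by apply: functional_extensionality_dep => y; rewrite big_ord0.
rewrite big_ord_recl -IH //.
have s2 : wsmooth false k%:Z setT (fun y => \sum_i s (lift ord0 i) y).
  exact: (wsmooth_sum (a := fun i => s (lift ord0 i)) openT (fun i => ss _)).
rewrite -(iconn_add conn openT (wsmooth_hinv (ss ord0)) (wsmooth_hinv s2)) //.
apply: (f_equal (fun t => D0 t v)).
by apply: functional_extensionality_dep => y; rewrite big_ord_recl.
Qed.

Lemma cov_smul a b x (v : tangent x) : smooth_series a -> smooth_series b ->
  cov (fun y => smul (a y) (b y)) x v =
  smul (cov a x v) (b x) + smul (a x) (cov b x v).
Proof.
move=> sa sb; apply/funext => k.
rewrite -[RHS]/(smul (cov a x v) (b x) k + smul (a x) (cov b x v) k) covE.
pose A : nat -> wfib x := fun i => Asec i x v.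
have delE : del v (smul (a x) (b x) k.+1) =
    \sum_(i < k.+1) del v (a x i.+1) * b x (k - i)%N +
    \sum_(i < k.+1) a x i * del v (b x (k - i).+1).
  rewrite {1}/smul linear_sum /=.
  under eq_bigr do rewrite delM.
  (* In degree [k + 1] the product has [k + 2] terms; those with [del] on a component of degree 0
     vanish, which leaves [k + 1] terms on either side. *)
  rewrite big_split /= [X in X + _]big_ord_recl [X in _ + X]big_ord_recr /=.
  rewrite (del_degree0 _ (sa 0%N)) mul0r add0r subnn (del_degree0 _ (sb 0%N)) mulr0 addr0.
  by congr (_ + _); apply: eq_bigr => i _; rewrite ?subSS // subSn // -ltnS.
have D0E : D0 (fun y => smul (a y) (b y) k) v =
    \sum_(i < k.+1) D0 (fun y => a y i) v * b x (k - i)%N +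
    \sum_(i < k.+1) a x i * D0 (fun y => b y (k - i)%N) v.
  rewrite -big_split /= (iconn_sum (k := k) (s := fun i y => a y i * b y (k - i)%N)).
    apply: eq_bigr => i _.
    exact: (iconn_mul conn openT (wsmooth_hinv (sa i)) (wsmooth_hinv (sb _)) v I).
  by move=> i; have := wsmooth_mul (sa i) (sb (k - i)%N); rewrite -PoszD subnKC // -ltnS.
have AE : \sum_(i < k.+1) wcomm (A i) (smul (a x) (b x) (k - i)%N) =
    \sum_(i < k.+1) (\sum_(j < i.+1) wcomm (A j) (a x (i - j)%N)) * b x (k - i)%N +
    \sum_(i < k.+1) a x i * (\sum_(j < (k - i).+1) wcomm (A j) (b x (k - i - j)%N)).
  rewrite sum_wcomm.
  under eq_bigr do rewrite sum_wcomm mulrBl.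
  under [X in _ = _ + X]eq_bigr do rewrite sum_wcomm mulrBr.
  exact: scomm_leibniz.
rewrite delE D0E [X in _ + X = _]AE.
rewrite [X in X + _ = _]addrACA [LHS]addrACA -!big_split /=.
apply: eq_bigr => i _; rewrite !covE; congr (_ + _).
  by rewrite [RHS]mulrDl [X in _ = X + _]mulrDl.
by rewrite [RHS]mulrDr [X in _ = X + _]mulrDr.
Qed.

(** Leibniz rule for [1 * 1 = 1]. *)
Lemma cov_sone x (v : tangent x) : cov (fun y => sone (wfib y)) x v = 0.
Proof.
have := cov_smul v smooth_series_sone smooth_series_sone.
rewrite (_ : (fun y => smul (sone (wfib y)) (sone (wfib y))) = (fun y => sone (wfib y))).
  rewrite smul1s smuls1 => /eqP; rewrite -subr_eq0 opprD addrA subrr add0r oppr_eq0.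
  by move=> /eqP.
by apply: functional_extensionality_dep => y; rewrite smul1s.
Qed.

Section Exponential.
Variable alpha : nat -> dform (fun _ : M => R[i]^o) 1.
Arguments alpha : clear implicits.

Lemma cserC x (v : tangent x) (b : nat -> wfib x) :
  smul (cser alpha v) b = smul b (cser alpha v).
Proof.
apply/funext => k; rewrite [RHS]/smul (reindex_inj rev_ord_inj).
apply: eq_bigr => i _ /=.
rewrite subSS subKn; last by rewrite -ltnS.
by apply/esym/subr0_eq; exact: wcomm_central.
Qed.

Variable a : forall x, wplus om x.
Hypotheses (sa : smooth_series a) (a0 : forall x, a x 0%N = 0).
Hypothesis cov_a : forall x (v : tangent x), cov a x v = cser alpha v.

(** [alpha] is central, so the Leibniz rule gives the power rule of commutative calculus. *)
Lemma cov_spow j x (v : tangent x) :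
  cov (fun y => spow (a y) j.+1) x v = smul (spow (a x) j) (cser alpha v) *+ j.+1.
Proof.
elim: j => [|j IH].
  have -> : cov (fun y => spow (a y) 1) x v = cov a x v.
    apply: (f_equal (fun s => cov s x v)).
    by apply: functional_extensionality_dep => y; rewrite spowS smuls1.
  by rewrite cov_a smul1s.
have -> : cov (fun y => spow (a y) j.+2) x v =
    cov (fun y => smul (a y) (spow (a y) j.+1)) x v by [].
rewrite (cov_smul v sa (smooth_series_spow j.+1 sa)) cov_a IH.
by rewrite smulMnr cserC smulA -spowS -mulrS.
Qed.

Lemma cov_sexp x (v : tangent x) :
  cov (fun y => sexp (a y)) x v = smul (sexp (a x)) (cser alpha v).
Proof.
apply/funext => k.
pose c (j : nat) : R[i] := (j`!%:R)^-1.
have sexpE y l N : (l < N)%N -> sexp (a y) l = \sum_(j < N) c j *: spow (a y) j l.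
  exact: (sum_spow_widen (fun j => wconst y (c j) : wfib y) (a0 y)).
(* Degree [k] of [cov] reaches up to components of degree [k + 1], for which the powers below
   [k + 2] suffice. *)
transitivity (cov (fun y => \sum_(j < k.+2) c j *: spow (a y) j) x v k).
  by apply: cov_agree => y l lk; rewrite (sexpE _ _ k.+2) // fct_sumE.
rewrite (cov_sum _ _ _ (fun j => smooth_series_spow j sa)).
(* The power 0 is parallel, and in the other terms the factor [j + 1] of the power rule turns
   [1 / (j + 1)!] into [1 / j!]. *)
rewrite big_ord_recl [X in _ *: X](_ : _ = 0) ?scaler0 ?add0r; last first.
  by have /= -> := cov_sone v.
transitivity (\sum_(j < k.+1) c j *: smul (spow (a x) j) (cser alpha v) k).
  apply: eq_bigr => j _; rewrite lift0 cov_spow.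
  have -> (s : nat -> wfib x) m : (s *+ m) k = s k *+ m.
    by elim: m => [|m IH]; rewrite ?mulr0n // !mulrS -IH.
  rewrite -scaler_nat scalerA; congr (_ *: _).
  rewrite /c factS natrM invfM mulrAC mulVf ?mul1r //.
rewrite [RHS]/smul.
under eq_bigr do rewrite /smul scaler_sumr.
rewrite exchange_big /=; apply: eq_bigr => i _.
rewrite (sexpE x i k.+1) // mulr_suml; apply: eq_bigr => j _.
exact/esym/wscaleAl.
Qed.

End Exponential.

Lemma scalar_form_opp (th : dform (fun _ : M => R[i]^o) 1) : scalar_form th ->
  scalar_form (fun x v => - th x v).
Proof.
move=> [thP th0 ths]; split.
- by move=> x v i r u u'; rewrite thP opprD scalerN.
- by move=> x v i j; rewrite !ord1.
- move=> c ac e; have [sr si] := ths c ac e.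
  have oc := cdom_open ac.
  split; [apply: smooth_fun_ext (oc) _ (smooth_funN oc sr)|
          apply: smooth_fun_ext (oc) _ (smooth_funN oc si)] => y _;
    by case: (th _ _).
Qed.

Lemma Zunit_sone : Zunit om (fun x => sone (wfib x)).
Proof.
have Z1 : Zsec om (fun x => sone (wfib x)).
  exists (fun m _ => (m == 0%N)%:R); first by move=> m; exact: smooth_cfun_cst openT.
  move=> x; apply/funext => k; rewrite /central /sone.
  case: k => [|k] /=; first by rewrite scale1r.
  case: ifP => // ok; rewrite (_ : (uphalf k == 0%N) = false) ?scale0r //.
  by case: k ok.
by split=> //; exists (fun x => sone (wfib x)) => // x; exact: smul1s.
Qed.

Lemma Wge1_smooth a : smooth_series a -> (forall x, a x 0%N = 0) -> Wge1 om a.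
Proof.
move=> sa a0; split=> // k.
have := wsmooth_mul (wsmooth_scale 'i openT (wsmooth_hbar false (@openT M))) (sa k).
by rewrite -[k.+2]add2n PoszD.
Qed.

End Fedosov.
End WeylBundle.

(** * Surjectivity of the logarithmic derivative *)

Theorem proposition5p22 (R : realType) (n : nat) (M : manifold R n)
    (om : symplectic_form M) (F : fedosov_connection om) :
  set_surj (Gnabla F) (Z1hbar om) (log_deriv F).
Proof.
move=> th [alpha alpha_ok thE].
have [a [sa a0 cov_a]] :=
  primitive F (fun m => (alpha_ok m).1) (fun m => (alpha_ok m).2).
pose g x := sexp (a x).
have g0 x : g x 0%N = 1.
  by rewrite /g /sexp big_ord1 /= invr1 scale1r.
have sg : smooth_series g by exact: smooth_series_sexp.
have nablaE s x (v : 'I_1 -> tangent x) :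
    nabla0 F s x v = covariant (fconn0 F) (fconnA F) s x (v ord0).
  exact: ext_deriv0E.
have logE x (w : tangent x) :
    smul (sinv (g x)) (covariant (fconn0 F) (fconnA F) g x w) = cser om alpha w.
  by rewrite (cov_sexp sa a0 cov_a) smulA (smulVs (g0 x)) smul1s.
exists g; last first.
  apply: functional_extensionality_dep => x; apply/funext => v.
  rewrite /log_deriv nablaE logE thE /central_form /cser.
  congr (central _ _ _); apply/funext => m; congr (alpha m x _).
  by apply/funext => i; rewrite (ord1 i).
split.
  exists (fun x => sone (wfib om x)), a; split; first exact: Zunit_sone.
    exact: Wge1_smooth.
  by move=> x; rewrite smul1s.
(* Differentiating [g^-1 g = 1] gives [nabla(g^-1) g = - g^-1 nabla g], that is [- alpha]. The
   Leibniz rule for this product requires the inverse of [g] to be smooth. *)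
exists (fun m x v => - alpha m x v).
  by move=> m; apply: scalar_form_opp; exact: (alpha_ok m).1.
have si := smooth_series_sinv sg g0.
move=> x v; rewrite nablaE.
have := cov_smul F (v ord0) si sg.
have -> : (fun y => smul (sinv (g y)) (g y)) = (fun y => sone (wfib om y)).
  by apply: functional_extensionality_dep => y; exact: smulVs (g0 y).
rewrite cov_sone logE => /esym/eqP; rewrite addr_eq0 => /eqP ->.
apply/funext => k; rewrite -[LHS]/(- cser om alpha (v ord0) k).
rewrite /cser /central_form /central.
case: (odd k); first exact: oppr0.
rewrite -[LHS]scaleNr; congr (- alpha _ x _ *: _).
by apply/funext => i; rewrite (ord1 i).
Qed.
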